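(* Let $n\ge2$. Suppose every component $f_i:\mathbb{R}^d\to\mathbb{R}$ is convex and differentiable with $L$-Lipschitz gradient, the average $F=\frac1n\sum_{i=1}^n f_i$ is $\mu$-strongly convex with $0<\mu\le L$ and unique minimizer $x_\star$, and, for some $\nu\in(0,1]$ and $\rho_\nu\ge0$, $F$ is twice differentiable with $\|\nabla^2F(u)-\nabla^2F(v)\|_{\mathrm{op}}\le\rho_\nu\|u-v\|^\nu$ for all $u,v$. Fix $\zeta>4$, put $\kappa=L/\mu$, $q_0=\zeta\kappa$, $q_k=q_0+nk$, and run random reshuffling with the stepsizes $$ \eta_{0,i}=\frac{2\zeta}{\mu(q_0+i)},\qquad \eta_{k,i}=\frac{2\zeta}{\mu q_{k+1}}\quad(k\ge1),\qquad i=1,\dots,n. $$ Assume there is a compact set $\mathcal X\subset\mathbb{R}^d$ containing $x_\star$ and every iterate $x_{k,i}$ of this run, uniformly over all epochs, inner positions and realizations of the permutations, and let $\bar G:=\max_{j}\sup_{z\in\mathcal X}\|\nabla f_j(z)\|<\infty$. Then there are constants $C_0,C_1,C_2,C_\nu>0$, independent of $n$ and $K$ and depending only on $\zeta,L,\mu,\rho_\nu,\nu,\bar G$, such that for every $K\ge1$, $$ \mathbb{E}\|y_K-x_\star\|^2\le C_0\left(\frac{q_0}{q_K}\right)^{\zeta}\|y_0-x_\star\|^2+\frac{C_1}{q_K^2}+\frac{C_2n^2}{q_K^3}+\frac{C_\nu n^{1+\nu}}{q_K^{2+2\nu}}. $$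
   Context: Random reshuffling (RR) with stepsizes $\eta_{k,i}$ starts from a deterministic point $y_0\in\mathbb{R}^d$. At each epoch $k=0,1,2,\dots$ it draws a fresh, independent, uniformly random permutation $\pi_k$ of $\{1,\dots,n\}$, sets $x_{k,0}=y_k$, performs $x_{k,i}=x_{k,i-1}-\eta_{k,i}\nabla f_{\pi_k(i)}(x_{k,i-1})$ for $i=1,\dots,n$, and sets $y_{k+1}=x_{k,n}$. Expectations are over the permutations. *)

(* Defs.v *)
(* The library norm on 'rV[R]_d is the max norm; it is used
   only for topological notions (differentiability, compactness), which do not
   depend on the choice of a norm.  Every metric quantity uses [enorm]. *)
From HB Require Import structures.
From mathcomp Require Import all_boot all_order all_algebra all_fingroup.
From mathcomp Require Import all_classical all_reals all_analysis.

Set Implicit Arguments.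
Unset Strict Implicit.
Unset Printing Implicit Defensive.
Import Order.TTheory GRing.Theory Num.Theory.
Import numFieldNormedType.Exports.
Local Open Scope classical_set_scope.
Local Open Scope ring_scope.

Definition enorm (R : realType) (d : nat) (v : 'rV[R]_d) : R :=
  Num.sqrt (\sum_(i < d) v 0 i ^+ 2).

(* Operator norm of v |-> v *m A with respect to [enorm]. *)
Definition opnorm (R : realType) (d : nat) (A : 'M[R]_d) : R :=
  sup [set enorm (v *m A) | v in [set v : 'rV[R]_d | enorm v <= 1]].

(* Only meaningful where f is differentiable. *)
Definition grad (R : realType) (d : nat) (f : 'rV[R]_d -> R)
    (x : 'rV[R]_d) : 'rV[R]_d :=
  \row_(i < d) 'D_(delta_mx 0 i) f x.

(* The entry (i, j) is the partial derivative along i of the j-th partial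
   derivative of f. *)
Definition hessian (R : realType) (d : nat) (f : 'rV[R]_d -> R)
    (x : 'rV[R]_d) : 'M[R]_d :=
  'J (grad f) x.

Definition twice_differentiable (R : realType) (d : nat)
    (f : 'rV[R]_d -> R) : Prop :=
  (forall x, differentiable f x) /\ (forall x, differentiable (grad f) x).

Definition lipschitz_gradient (R : realType) (d : nat) (L : R)
    (f : 'rV[R]_d -> R) : Prop :=
  forall u v, enorm (grad f u - grad f v) <= L * enorm (u - v).

Definition strongly_convex (R : realType) (d : nat) (mu : R)
    (f : 'rV[R]_d -> R) : Prop :=
  forall (x y : 'rV[R]_d) (t : R), 0 <= t <= 1 ->
    f (t *: x + (1 - t) *: y) <=
      t * f x + (1 - t) * f y - mu / 2 * (t * (1 - t)) * enorm (x - y) ^+ 2.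

Definition average (R : realType) (d n : nat) (f : 'I_n -> 'rV[R]_d -> R)
    (x : 'rV[R]_d) : R :=
  n%:R^-1 * \sum_(i < n) f i x.

Definition unique_minimizer (R : realType) (d : nat) (f : 'rV[R]_d -> R)
    (xs : 'rV[R]_d) : Prop :=
  [set x | forall z, f x <= f z] = [set xs].

(* Components and positions in a permutation are numbered from 0, the iterates
   x_{k,i} and the stepsizes eta k i keep the numbering 0 <= i <= n (resp.
   1 <= i <= n): the step from x_{k,i} to x_{k,i+1} uses the component s i and
   the stepsize eta k i.+1.  The [None] branch is reached only for i >= n. *)
Fixpoint rr_epoch (R : realType) (d n : nat) (f : 'I_n -> 'rV[R]_d -> R)
    (eta : nat -> R) (s : 'S_n) (y : 'rV[R]_d) (i : nat) : 'rV[R]_d :=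
  match i with
  | 0 => y
  | i'.+1 =>
      let x := rr_epoch f eta s y i' in
      if (insub i' : option 'I_n) is Some j
      then x - eta i'.+1 *: grad (f (s j)) x
      else x
  end.

(* y_k *)
Fixpoint rr_point (R : realType) (d n : nat) (f : 'I_n -> 'rV[R]_d -> R)
    (eta : nat -> nat -> R) (y0 : 'rV[R]_d) (s : nat -> 'S_n) (k : nat) :
    'rV[R]_d :=
  match k with
  | 0 => y0
  | k'.+1 => rr_epoch f (eta k') (s k') (rr_point f eta y0 s k') n
  end.

(* x_{k,i} *)
Definition rr_iter (R : realType) (d n : nat) (f : 'I_n -> 'rV[R]_d -> R)
    (eta : nat -> nat -> R) (y0 : 'rV[R]_d) (s : nat -> 'S_n) (k i : nat) :
    'rV[R]_d :=
  rr_epoch f (eta k) (s k) (rr_point f eta y0 s k) i.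

(* All subsets of 'S_n are regarded as measurable: it suffices to ask for the
   measurability of the preimages of singletons. *)
Definition uniform_perm (disp : measure_display) (T : measurableType disp)
    (R : realType) (P : probability T R) (n : nat) (X : T -> 'S_n) : Prop :=
  forall s : 'S_n, measurable (X @^-1` [set s]) /\
    P (X @^-1` [set s]) = ((n`!%:R : R)^-1)%:E.

Definition independent_family (disp : measure_display)
    (T : measurableType disp) (R : realType) (P : probability T R)
    (S : finType) (X : nat -> T -> S) : Prop :=
  forall (J : seq nat) (A : nat -> set S), uniq J ->
    P (\bigcap_(k in [set` J]) (X k @^-1` A k)) =
    (\prod_(k <- J) P (X k @^-1` A k))%E.

(* q_k = zeta * kappa + n * k with kappa = L / mu *)
Definition qpar (R : realType) (zeta L mu : R) (n k : nat) : R :=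
  zeta * (L / mu) + (n * k)%N%:R.

Definition stepsize (R : realType) (zeta L mu : R) (n k i : nat) : R :=
  if k == 0%N then 2 * zeta / (mu * (qpar zeta L mu n 0 + i%:R))
  else 2 * zeta / (mu * qpar zeta L mu n k.+1).

(* The running value 0 of the maximum is harmless: all suprema are >= 0. *)
Definition max_grad (R : realType) (d n : nat) (f : 'I_n -> 'rV[R]_d -> R)
    (X : set 'rV[R]_d) : R :=
  \big[Num.max/0]_(j < n) sup [set enorm (grad (f j) z) | z in X].

(* Main.v *)
(* On the compact set X all gradients are bounded by G, so every iterate is
   within D = G / mu of xs.  Conditional expectations are never needed: an
   average over 'S_n is invariant under s |-> tperm i t * s, which exchanges two
   positions, and a family with zero sum, sampled without replacement, has
   negatively correlated terms.
   In the first epoch the first n mu / (2 L) steps behave like SGD with steps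
   O(1 / i), since the components not yet drawn keep half of the strong
   monotonicity of the average; this gives E|e|^2 = O(1 / n), and a Gronwall
   argument preserves this order during any fixed number of epochs.
   In a later epoch with constant step h, the bias of the summed gradients is
   estimated by the swap coupling (O(h) per step), and by expanding the gradient
   of the average, the only function with a regular Hessian, at the start y of
   the epoch.  The outcome is
     E|e'|^2 <= (1 - 8 n / q) |e|^2
                + B (n / q) (1/q^2 + n^2/q^3 + n^(1+nu)/q^(2+2nu)),
   with q = q_{k+1}.  As 8 exceeds every exponent of q in the last factor, an
   induction on k gives the rate without any use of the initial distance. *)
Require Import Defs.
From HB Require Import structures.
From mathcomp Require Import all_boot all_order all_algebra all_fingroup.
From mathcomp Require Import all_classical all_reals all_analysis.
From mathcomp Require Import measurable_realfun ring lra.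

Set Implicit Arguments.
Unset Strict Implicit.
Unset Printing Implicit Defensive.
Import Order.TTheory GRing.Theory Num.Theory.
Import numFieldNormedType.Exports.
Local Open Scope classical_set_scope.
Local Open Scope ring_scope.

(** During any bounded number of epochs [q_k] is of order n, so n^2 / q^3 is of order 1/n and a
    bound O(1/n) is all that has to be shown there. The distance bound G / mu does not give it, so
    the gain 1/n must come from epoch 0 itself, where the steps are not small and the epoch is not a
    perturbed full gradient step. In later epochs the obstacle is the inner displacement: the noise
    alone moves the iterate by about e sqrt(n), and a pathwise Lipschitz estimate of the resulting
    error would lose a factor sqrt(n). The error enters linearly only through its mean over the
    permutations. The first-order Taylor part averages to the Hessian applied to the mean
    displacement, in which the noise largely cancels; only the remainder sees the full displacement,
    and this produces n^(1+nu) / q^(2+2nu). The number 8 is the lower bound of c mu = 2 zeta, where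
    c / q is the step: of the contraction 2 e n mu, half pays for the error terms and e n mu = 2
    zeta n / q remains. *)

Definition edot (R : realType) (d : nat) (u v : 'rV[R]_d) : R :=
  \sum_(i < d) u 0 i * v 0 i.

(** * Euclidean inner product and norm *)

Section Euclidean.
Context {R : realType} {d : nat}.
Implicit Types u v w : 'rV[R]_d.

Lemma edotC u v : edot u v = edot v u.
Proof. by apply: eq_bigr => i _; rewrite mulrC. Qed.

Lemma edotDl u v w : edot (u + v) w = edot u w + edot v w.
Proof. by rewrite -big_split; apply: eq_bigr => i _; rewrite mxE mulrDl. Qed.

Lemma edotZl a u v : edot (a *: u) v = a * edot u v.
Proof. by rewrite mulr_sumr; apply: eq_bigr => i _; rewrite mxE mulrA. Qed.

Lemma edotDr u v w : edot u (v + w) = edot u v + edot u w.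
Proof. by rewrite edotC edotDl !(edotC u). Qed.

Lemma edotZr a u v : edot u (a *: v) = a * edot u v.
Proof. by rewrite edotC edotZl (edotC u). Qed.

Lemma edotNl u v : edot (- u) v = - edot u v.
Proof. by rewrite -scaleN1r edotZl mulN1r. Qed.

Lemma edotNr u v : edot u (- v) = - edot u v.
Proof. by rewrite edotC edotNl (edotC u). Qed.

Definition edotE := (edotDl, edotDr, edotNl, edotNr, edotZl, edotZr).

Lemma edot0l u : edot 0 u = 0.
Proof. by rewrite -(scale0r 0) edotZl mul0r. Qed.

Lemma edot_suml (I : Type) (r : seq I) (p : pred I) (F : I -> 'rV[R]_d) v :
  edot (\sum_(i <- r | p i) F i) v = \sum_(i <- r | p i) edot (F i) v.
Proof.
by elim/big_ind2: _ => [|x a y b <- <-|//]; [exact: edot0l|rewrite edotDl].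
Qed.

Lemma edot_sumr (I : Type) (r : seq I) (p : pred I) (F : I -> 'rV[R]_d) v :
  edot v (\sum_(i <- r | p i) F i) = \sum_(i <- r | p i) edot v (F i).
Proof. by rewrite edotC edot_suml; apply: eq_bigr => i _; rewrite edotC. Qed.

Lemma edot_ge0 u : 0 <= edot u u.
Proof. by apply: sumr_ge0 => i _; rewrite -expr2 sqr_ge0. Qed.

Lemma enorm_ge0 u : 0 <= enorm u.
Proof. exact: sqrtr_ge0. Qed.

Lemma enorm_sqr u : enorm u ^+ 2 = edot u u.
Proof.
rewrite sqr_sqrtr; first by apply: eq_bigr => i _; rewrite expr2.
by apply: sumr_ge0 => i _; rewrite sqr_ge0.
Qed.

Lemma enorm_eq0 u : (enorm u == 0) = (u == 0).
Proof.
rewrite -sqrf_eq0 enorm_sqr psumr_eq0; last by move=> i _; rewrite -expr2 sqr_ge0.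
apply/allP/eqP => [h|-> i _]; last by rewrite mxE mul0r eqxx implybT.
apply/rowP => i; rewrite mxE; apply/eqP.
by have := h i (mem_index_enum i); rewrite mulf_eq0 orbb.
Qed.

Lemma enorm0 : enorm (0 : 'rV[R]_d) = 0.
Proof. by apply/eqP; rewrite enorm_eq0. Qed.

Lemma edot_sqr_le u v : edot u v ^+ 2 <= edot u u * edot v v.
Proof.
have [->|v0] := eqVneq v 0.
  by rewrite edotC !edot0l expr0n mulr0.
have vv : 0 < edot v v by rewrite -enorm_sqr exprn_gt0// lt_def enorm_eq0 v0 enorm_ge0.
have := edot_ge0 (edot v v *: u - edot u v *: v).
rewrite !edotE (edotC v u) => h.
have : 0 <= edot v v * (edot u u * edot v v - edot u v ^+ 2) by lra.
by rewrite pmulr_rge0 // subr_ge0.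
Qed.

Lemma edot_le u v : edot u v <= enorm u * enorm v.
Proof.
have := edot_sqr_le u v; rewrite -!enorm_sqr -exprMn => h.
apply: le_trans (ler_norm _) _.
by rewrite -(@ler_pXn2r _ 2) ?nnegrE ?mulr_ge0 ?enorm_ge0// real_normK ?num_real.
Qed.

Lemma enormZ a u : enorm (a *: u) = `|a| * enorm u.
Proof.
apply/eqP; rewrite -(@eqrXn2 _ 2) ?mulr_ge0 ?enorm_ge0//.
by rewrite exprMn !enorm_sqr !edotE real_normK ?num_real// expr2 mulrA.
Qed.

Lemma enormN u : enorm (- u) = enorm u.
Proof. by rewrite -scaleN1r enormZ normrN1 mul1r. Qed.

Lemma enorm_subC u v : enorm (u - v) = enorm (v - u).
Proof. by rewrite -enormN opprB. Qed.

Lemma enormD u v : enorm (u + v) <= enorm u + enorm v.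
Proof.
rewrite -(@ler_pXn2r _ 2) ?nnegrE ?addr_ge0 ?enorm_ge0//.
rewrite enorm_sqr !edotE (edotC v u) sqrrD !enorm_sqr.
by have := edot_le u v; lra.
Qed.

Lemma enormB u v : enorm (u - v) <= enorm u + enorm v.
Proof. by rewrite -(enormN v) enormD. Qed.

Lemma enorm_sum (I : Type) (r : seq I) (p : pred I) (F : I -> 'rV[R]_d) :
  enorm (\sum_(i <- r | p i) F i) <= \sum_(i <- r | p i) enorm (F i).
Proof.
apply: (big_ind2 (fun u a => enorm u <= a)) => [|u a v b ha hb|//].
  by rewrite enorm0.
by apply: le_trans (enormD _ _) _; exact: lerD.
Qed.

Lemma enormD_sqr u v : enorm (u + v) ^+ 2 <= 2 * enorm u ^+ 2 + 2 * enorm v ^+ 2.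
Proof.
have := edot_ge0 (u - v); rewrite !enorm_sqr !edotE (edotC v u); lra.
Qed.

(** Duality, by taking [w := u]. It reduces a vector estimate to scalar functions, for which the
    mean value theorem holds as an equality. *)
Lemma enorm_le_of_edot u (B : R) :
  0 <= B -> (forall w, edot u w <= B * enorm w) -> enorm u <= B.
Proof.
move=> B0 /(_ u); rewrite -enorm_sqr expr2.
have [->//|u0] := eqVneq (enorm u) 0.
by rewrite ler_pM2r// lt_def u0 enorm_ge0.
Qed.

End Euclidean.

(** * Gradients and Hessians *)

Section Calculus.
Context {R : realType} {d : nat}.
Implicit Types (f : 'rV[R]_d -> R) (g : 'rV[R]_d -> 'rV[R]_d).
Implicit Types x y u v w : 'rV[R]_d.

Lemma derive_edot_grad f x v :
  differentiable f x -> 'D_v f x = edot (grad f x) v.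
Proof.
move=> df; rewrite deriveE // {1}(row_sum_delta v) linear_sum /=.
apply: eq_bigr => i _.
by rewrite linearZ /= mxE mulrC deriveE.
Qed.

(** The slack [t ^+ 2 * b] makes room for the modulus of strong convexity; it vanishes in the
    difference quotient. *)
Lemma le_derive f x v (a b : R) : derivable f x v ->
  (forall t, 0 < t <= 1 -> t * a - t ^+ 2 * b <= f (x + t *: v) - f x) ->
  a <= 'D_v f x.
Proof.
move=> df h; apply/ler_addgt0Pr => e e0.
have cv : (fun h : R => h^-1 *: ((f \o shift x) (h *: v) - f x)) t
   @[t --> 0^'+] --> 'D_v f x by apply: cvg_dnbhs_at_right.
have e2 : 0 < e / 2 by lra.
have hD : 'D_v f x < 'D_v f x + e / 2 by lra.
have cv' := cvgr_le _ cv _ hD.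
have c0 : 0 < e / 2 / (`|b| + 1) by rewrite divr_gt0 // ltr_pwDr.
have : \forall t \near (0 : R)^'+, a <= 'D_v f x + e.
  near=> t.
  have t0 : 0 < t by near: t; exact: nbhs_right_gt.
  have t1 : t <= 1 by near: t; exact: nbhs_right_le.
  have tb : t <= e / 2 / (`|b| + 1) by near: t; exact: nbhs_right_le.
  have : t^-1 *: ((f \o shift x) (t *: v) - f x) <= 'D_v f x + e / 2.
    by near: t; exact: cv'.
  move=> hq.
  have ht := h t; rewrite t0 t1 in ht; have {}ht := ht isT.
  have : a - t * b <= 'D_v f x + e / 2.
    apply: le_trans hq.
    rewrite [leRHS](_ : _ = t^-1 * (f (x + t *: v) - f x)); last first.
      by rewrite /= (addrC x).
    by rewrite ler_pdivlMl //; apply: le_trans ht; lra.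
  have : t * b <= e / 2.
    apply: le_trans (_ : t * (`|b| + 1) <= _).
      by rewrite ler_pM2l // (le_trans (ler_norm b)) // lerDl.
    by rewrite -ler_pdivlMr // ltr_pwDr.
  by lra.
by move=> /filter_ex [].
Unshelve. all: by end_near. Qed.

Lemma strongly_convex_grad f mu x y :
  (forall z, differentiable f z) -> strongly_convex mu f ->
  edot (grad f y) (x - y) <= f x - f y - mu / 2 * enorm (x - y) ^+ 2.
Proof.
move=> df sc; rewrite -derive_edot_grad //.
(* The tangent inequality bounds a derivative from above, so [le_derive] is applied to [- f]. *)
rewrite -[leLHS]opprK lerNl -deriveN; last exact: diff_derivable.
apply: (@le_derive _ _ _ _ (mu / 2 * enorm (x - y) ^+ 2)).
  exact/derivableN/diff_derivable.
move=> t /andP[t0 t1].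
have := sc x y t; rewrite (ltW t0) t1 => /(_ isT).
have -> : t *: x + (1 - t) *: y = y + t *: (x - y).
  by rewrite scalerBl scale1r scalerBr addrCA.
rewrite !fctE => h.
by lra.
Qed.

Lemma strongly_convex_monotone f mu x y :
  (forall z, differentiable f z) -> strongly_convex mu f ->
  mu * enorm (x - y) ^+ 2 <= edot (grad f x - grad f y) (x - y).
Proof.
move=> df sc.
have := strongly_convex_grad x y df sc; have := strongly_convex_grad y x df sc.
rewrite (enorm_subC y x) -(opprB x y) !edotE; lra.
Qed.

Lemma grad_minimizer f x :
  differentiable f x -> (forall z, f x <= f z) -> grad f x = 0.
Proof.
move=> df fmin; apply/eqP; rewrite -enorm_eq0 -sqrf_eq0 enorm_sqr.
(* Test direction [- grad f x]: the derivative there is minus the squared norm, and it is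
   nonnegative at a minimizer. *)
rewrite eq_le edot_ge0 andbT -oppr_ge0 -edotNr -derive_edot_grad //.
apply: (@le_derive _ _ _ _ 0); first exact: diff_derivable.
by move=> t _; rewrite !mulr0 subrr subr_ge0.
Qed.

Lemma grad_average n (f : 'I_n -> 'rV[R]_d -> R) x :
  (forall i, differentiable (f i) x) ->
  grad (average f) x = n%:R^-1 *: \sum_(i < n) grad (f i) x.
Proof.
move=> df; apply/rowP => j; rewrite !mxE summxE.
have -> : average f = n%:R^-1 \*: (\sum_(i < n) f i).
  by apply/funext => z; rewrite /average /= fct_sumE.
have dfj i : derivable (f i) x (delta_mx 0 j) by exact: diff_derivable.
rewrite deriveZ; last exact: derivable_sum.
rewrite derive_sum // /GRing.scale /=; congr (_ * _).
by apply: eq_bigr => i _; rewrite mxE.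
Qed.

Lemma edotl_continuous w : continuous (fun u => edot u w).
Proof.
rewrite (_ : (fun u => _) = \sum_(i < d) (fun u => u 0 i * w 0 i)); last first.
  by apply/funext => u; rewrite fct_sumE.
apply: (big_ind (fun F : 'rV[R]_d -> R => continuous F)) => [|F G cF cG|i _] u.
- exact: cst_continuous.
- by apply: continuousD; [exact: cF|exact: cG].
- by apply: continuousM; [exact: coord_continuous|exact: cst_continuous].
Qed.

Lemma is_derive_line g x v (t : R) :
  derivable g (x + t *: v) v ->
  is_derive t 1 (fun s => g (x + s *: v)) ('D_v g (x + t *: v)).
Proof.
move=> dg.
have E : (fun h : R => h^-1 *: (((fun s => g (x + s *: v)) \o shift t) (h *: 1)
            - g (x + t *: v))) =
         (fun h : R => h^-1 *: ((g \o shift (x + t *: v)) (h *: v)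
            - g (x + t *: v))).
  apply/funext => h /=; congr (_ *: (g _ - _)).
  by rewrite [h%:A](mulr1 h) scalerDl addrCA.
by split; rewrite /derivable /derive E.
Qed.

Lemma is_derive_edotl (h : R -> 'rV[R]_d) (t : R) (dh w : 'rV[R]_d) :
  is_derive t 1 h dh -> is_derive t 1 (fun s => edot (h s) w) (edot dh w).
Proof.
move=> [dh1 dh2].
have cv : (fun s : R => s^-1 *: (((fun s => edot (h s) w) \o shift t) (s *: 1)
            - edot (h t) w)) @ 0^' --> edot dh w.
  have -> : (fun s : R => s^-1 *: (((fun s => edot (h s) w) \o shift t) (s *: 1)
            - edot (h t) w)) =
    (fun u => edot u w) \o
      (fun s : R => s^-1 *: ((h \o shift t) (s *: 1) - h t)).
    by apply/funext => s /=; rewrite !edotE.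
  have cq : (fun s : R => s^-1 *: ((h \o shift t) (s *: 1) - h t)) @ 0^' --> dh.
    by rewrite -dh2; exact: dh1.
  exact: cvg_comp cq (@edotl_continuous w dh).
by split; [apply/cvg_ex; eexists; exact: cv|exact: cvg_lim].
Qed.

(** The Frobenius bound serves only to show that the set in [opnorm] is bounded above, so that its
    [sup] is an upper bound. *)
Lemma enorm_mulmx (A : 'M[R]_d) v :
  enorm (v *m A) <= enorm v * Num.sqrt (\sum_i \sum_j A i j ^+ 2).
Proof.
have S0 : 0 <= \sum_i \sum_j A i j ^+ 2.
  by apply: sumr_ge0 => i _; apply: sumr_ge0 => j _; exact: sqr_ge0.
rewrite -(@ler_pXn2r _ 2) ?nnegrE ?mulr_ge0 ?enorm_ge0 ?sqrtr_ge0//.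
rewrite exprMn (sqr_sqrtr S0) enorm_sqr exchange_big /= mulr_sumr.
rewrite {1}/edot; apply: ler_sum => j _; rewrite -expr2 mxE enorm_sqr.
have -> : \sum_i v 0 i * A i j = edot v (\row_i A i j).
  by apply: eq_bigr => i _; rewrite mxE.
apply: le_trans (edot_sqr_le _ _) _.
suff -> : edot (\row_i A i j) (\row_i A i j) = \sum_i A i j ^+ 2 by [].
by apply: eq_bigr => i _; rewrite !mxE expr2.
Qed.

Lemma enorm_mulmx_opnorm (A : 'M[R]_d) v :
  enorm (v *m A) <= opnorm A * enorm v.
Proof.
have [->|v0] := eqVneq v 0; first by rewrite mul0mx enorm0 mulr0.
have ev : 0 < enorm v by rewrite lt_def enorm_eq0 v0 enorm_ge0.
have vV : 0 <= (enorm v)^-1 by rewrite invr_ge0 ltW.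
rewrite -ler_pdivrMr //.
apply: ub_le_sup.
  exists (Num.sqrt (\sum_i \sum_j A i j ^+ 2)) => _ [u /= u1 <-].
  apply: le_trans (enorm_mulmx A u) _.
  by rewrite ler_piMl // sqrtr_ge0.
exists ((enorm v)^-1 *: v) => /=.
  by rewrite enormZ ger0_norm // mulVf ?gt_eqF.
by rewrite -scalemxAl enormZ ger0_norm // mulrC.
Qed.

(** For a fixed [w], the mean value theorem on the segment gives a point c in (0, 1) at which the
    Hessians are compared. The factor [c ^ nu] is bounded by 1, hence the constant [rho] instead of
    rho / (1 + nu). *)
Lemma grad_taylor f (rho nu : R) x y : 0 <= nu -> 0 <= rho ->
  twice_differentiable f ->
  (forall u v, opnorm (hessian f u - hessian f v) <= rho * enorm (u - v) `^ nu) ->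
  enorm (grad f x - grad f y - (x - y) *m hessian f y) <=
    rho * enorm (x - y) `^ (1 + nu).
Proof.
move=> nu0 rho0 [_ dg] Hh; set v := x - y.
apply: enorm_le_of_edot => [|w]; first by rewrite mulr_ge0 // powR_ge0.
have yv : y + v = x by rewrite /v addrC subrK.
pose phi (s : R) := edot (grad f (y + s *: v)) w.
have dphi (s : R) : is_derive s 1 phi (edot (v *m hessian f (y + s *: v)) w).
  rewrite -deriveEjacobian //.
  apply: is_derive_edotl; apply: is_derive_line.
  exact: diff_derivable.
have [|c c01] := @MVT R phi (fun s => edot (v *m hessian f (y + s *: v)) w) 0 1
    ltr01 (fun s _ => dphi s).
  apply: derivable_within_continuous => s _; exact: ex_derive.
rewrite subr0 mulr1 /phi scale1r scale0r addr0 yv => E.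
rewrite !edotE -addrA -opprD opprD addrA E -edotNl -edotDl -mulmxBr.
apply: le_trans (edot_le _ _) _; rewrite ler_wpM2r ?enorm_ge0 //.
apply: le_trans (enorm_mulmx_opnorm _ _) _.
rewrite powRD; last by rewrite (gt_eqF _) // ltr_pwDl.
rewrite powRr1 ?enorm_ge0 // mulrCA mulrC ler_wpM2l ?enorm_ge0 //.
apply: le_trans (Hh _ _) _; rewrite ler_wpM2l //.
rewrite addrAC subrr add0r enormZ.
move: c01; rewrite in_itv /= => /andP[c0 c1].
apply: ge0_ler_powR => //; rewrite ?nnegrE ?mulr_ge0 ?enorm_ge0 //.
by rewrite ger0_norm ?(ltW c0) // ler_piMl ?enorm_ge0 // ltW.
Qed.

End Calculus.

(** * Finite sums and averages over permutations *)

Section Sums.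
Context {R : realType}.

Lemma sum_sqr_le n (p : pred 'I_n) (a : 'I_n -> R) :
  (\sum_(j < n | p j) a j) ^+ 2 <= n%:R * \sum_(j < n | p j) a j ^+ 2.
Proof.
have := edot_sqr_le (\row_j (if p j then a j else 0)) (const_mx 1).
have -> : edot (const_mx 1 : 'rV[R]_n) (const_mx 1) = n%:R.
  rewrite /edot; under eq_bigr do rewrite !mxE mulr1.
  by rewrite sumr_const card_ord.
have -> : edot (\row_j (if p j then a j else 0)) (const_mx 1) = \sum_(j < n | p j) a j.
  by rewrite big_mkcond; apply: eq_bigr => j _; rewrite !mxE mulr1.
rewrite mulrC; congr (_ <= _ * _).
rewrite [RHS]big_mkcond; apply: eq_bigr => j _; rewrite !mxE -expr2.
by case: ifP => // _; rewrite expr0n.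
Qed.

Lemma enorm_sum_sqr n d (p : pred 'I_n) (F : 'I_n -> 'rV[R]_d) :
  enorm (\sum_(j < n | p j) F j) ^+ 2 <=
    n%:R * \sum_(j < n | p j) enorm (F j) ^+ 2.
Proof.
apply: le_trans (sum_sqr_le p (fun j => enorm (F j))).
rewrite ler_pXn2r ?nnegrE ?enorm_ge0 ?enorm_sum //.
by apply: sumr_ge0 => j _; exact: enorm_ge0.
Qed.

Lemma big_ord_rangeS (V : nmodType) n m (i : 'I_n) (F : 'I_n -> V) :
  (m <= i)%N -> \sum_(j < n | (m <= j < i.+1)%N) F j =
  \sum_(j < n | (m <= j < i)%N) F j + F i.
Proof.
move=> mi; rewrite (bigD1 i) /= ?mi ?ltnSn // addrC; congr (_ + _).
apply: eq_bigl => j; rewrite ltnS -val_eqE /=.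
by rewrite [(j < i)%N]ltn_neqAle -andbA [(_ <= i)%N && _]andbC.
Qed.

Lemma discrete_gronwall (u : nat -> R) (A B : R) m n :
  0 <= A -> 0 <= B ->
  (forall i, (m <= i <= n)%N ->
    u i <= A + B * \sum_(j < n | (m <= j < i)%N) u j) ->
  forall i, (m <= i <= n)%N -> u i <= A * expR (B * n%:R).
Proof.
move=> A0 B0 h.
(* The induction runs on the right-hand side of the hypothesis, which grows by a factor of at most 1
   + B per index. *)
have S k : (m + k <= n)%N ->
    A + B * \sum_(j < n | (m <= j < m + k)%N) u j <= A * (1 + B) ^+ k.
  elim: k => [|k IH] kn.
    rewrite big_pred0 ?mulr0 ?addr0 ?mulr1 // => j.
    by rewrite addn0 leqNgt andNb.
  have mkn : (m + k < n)%N by rewrite -addnS.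
  have {}IH := IH (ltnW mkn).
  rewrite addnS (@big_ord_rangeS _ n m (Ordinal mkn)) /= ?leq_addr //.
  have := h (m + k)%N; rewrite leq_addr ltnW // => /(_ isT) hu.
  rewrite exprSr mulrA mulrDr addrA mulrDr mulr1.
  by rewrite lerD // [leRHS]mulrC ler_wpM2l // (le_trans hu).
move=> i /andP[mi iln].
apply: le_trans (h i _) _; first by rewrite mi.
have := S (i - m)%N; rewrite subnKC // => /(_ iln) Si; apply: le_trans Si _.
rewrite ler_wpM2l //.
apply: (@le_trans _ _ (expR B ^+ (i - m))).
  by rewrite lerXn2r ?nnegrE ?addr_ge0 ?expR_ge0 // expR_ge1Dx.
rewrite -expRM_natl ler_expR mulrC ler_wpM2l // ler_nat.
exact: leq_trans (leq_subr _ _) iln.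
Qed.

End Sums.

HB.lock Definition savg (R : realType) (n : nat) (phi : 'S_n -> R) : R :=
  (n`!%:R)^-1 * \sum_s phi s.

HB.lock Definition vavg (R : realType) (n d : nat) (V : 'S_n -> 'rV[R]_d) :
  'rV[R]_d := (n`!%:R)^-1 *: \sum_s V s.

Section PermAverage.
Context {R : realType} {n d : nat}.
Implicit Types (phi psi : 'S_n -> R) (V W : 'S_n -> 'rV[R]_d).

Let fact_gt0R : (0 : R) < n`!%:R. Proof. by rewrite ltr0n fact_gt0. Qed.
Let fact_neq0 : n`!%:R != 0 :> R. Proof. by rewrite gt_eqF. Qed.

Lemma ler_savg phi psi : (forall s, phi s <= psi s) -> savg phi <= savg psi.
Proof.
move=> h; rewrite savg.unlock ler_wpM2l ?invr_ge0 ?ler0n //.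
by apply: ler_sum => s _; exact: h.
Qed.

Lemma eq_savg phi psi : (forall s, phi s = psi s) -> savg phi = savg psi.
Proof. by move=> h; rewrite savg.unlock; congr (_ * _); apply: eq_bigr => s _; exact: h. Qed.

Lemma savg_cst (c : R) : savg (fun _ : 'S_n => c) = c.
Proof. by rewrite savg.unlock sumr_const card_Sn -[c *+ _]mulr_natl mulKf. Qed.

Lemma savg_ge0 phi : (forall s, 0 <= phi s) -> 0 <= savg phi.
Proof. by move=> h; rewrite -(savg_cst 0); exact: ler_savg. Qed.

Lemma savgD phi psi : savg (fun s => phi s + psi s) = savg phi + savg psi.
Proof. by rewrite savg.unlock big_split mulrDr. Qed.

Lemma savgZ (c : R) phi : savg (fun s => c * phi s) = c * savg phi.
Proof. by rewrite savg.unlock -mulr_sumr mulrCA. Qed.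

Lemma savg_sum (I : finType) (p : pred I) (F : I -> 'S_n -> R) :
  savg (fun s => \sum_(i | p i) F i s) = \sum_(i | p i) savg (F i).
Proof. by rewrite savg.unlock exchange_big mulr_sumr. Qed.

Lemma savg_reindex (t : 'S_n) phi : savg (fun s => phi (t * s)%g) = savg phi.
Proof. by rewrite savg.unlock; congr (_ * _); rewrite [RHS](reindex_inj (mulgI t)). Qed.

Lemma savg_sqr_le phi : savg phi ^+ 2 <= savg (fun s => phi s ^+ 2).
Proof.
set m := savg phi.
have : 0 <= savg (fun s => (phi s - m) ^+ 2).
  by apply: savg_ge0 => s; exact: sqr_ge0.
rewrite (@eq_savg _ (fun s => phi s ^+ 2 + ((- (2 * m)) * phi s + m ^+ 2))).
  by rewrite !savgD savgZ savg_cst -/m; lra.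
by move=> s; ring.
Qed.

Lemma eq_vavg V W : (forall s, V s = W s) -> vavg V = vavg W.
Proof. by move=> h; rewrite vavg.unlock; congr (_ *: _); apply: eq_bigr => s _; exact: h. Qed.

Lemma vavgD V W : vavg (fun s => V s + W s) = vavg V + vavg W.
Proof. by rewrite vavg.unlock big_split scalerDr. Qed.

Lemma vavgZ (c : R) V : vavg (fun s => c *: V s) = c *: vavg V.
Proof. by rewrite vavg.unlock -scaler_sumr !scalerA mulrC. Qed.

Lemma vavgN V : vavg (fun s => - V s) = - vavg V.
Proof. by rewrite vavg.unlock sumrN scalerN. Qed.

Lemma vavg_cst (v : 'rV[R]_d) : vavg (fun _ : 'S_n => v) = v.
Proof. by rewrite vavg.unlock sumr_const card_Sn -[v *+ _]scaler_nat scalerA mulVf ?scale1r. Qed.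

Lemma vavg_sum (I : finType) (p : pred I) (F : I -> 'S_n -> 'rV[R]_d) :
  vavg (fun s => \sum_(i | p i) F i s) = \sum_(i | p i) vavg (F i).
Proof. by rewrite vavg.unlock exchange_big scaler_sumr. Qed.

Lemma vavg_reindex (t : 'S_n) V : vavg (fun s => V (t * s)%g) = vavg V.
Proof. by rewrite vavg.unlock; congr (_ *: _); rewrite [RHS](reindex_inj (mulgI t)). Qed.

Lemma vavg_mulmx V (A : 'M[R]_d) : vavg (fun s => V s *m A) = vavg V *m A.
Proof. by rewrite vavg.unlock -mulmx_suml scalemxAl. Qed.

Lemma savg_edot V w : savg (fun s => edot w (V s)) = edot w (vavg V).
Proof. by rewrite savg.unlock vavg.unlock edotZr edot_sumr. Qed.

Lemma enorm_vavg V : enorm (vavg V) <= savg (fun s => enorm (V s)).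
Proof.
rewrite vavg.unlock savg.unlock enormZ ger0_norm ?invr_ge0 ?ler0n // ler_wpM2l ?invr_ge0 ?ler0n //.
exact: enorm_sum.
Qed.

(* Exchanging the positions [i] and [t] leaves a prefix of length [i]
   untouched, so [s i] is exchangeable with each of the remaining values. *)
Lemma savg_remaining (i : 'I_n) (phi : 'S_n -> 'I_n -> R) :
  (forall (t : 'I_n) s r, (i <= t)%N -> phi (tperm i t * s)%g r = phi s r) ->
  savg (fun s => \sum_(t < n | (i <= t)%N) phi s (s t)) =
  (n - i)%:R * savg (fun s => phi s (s i)).
Proof.
move=> h; rewrite savg_sum.
under eq_bigr => t it.
  rewrite -(savg_reindex (tperm i t)).
  under eq_savg do rewrite h // permM tpermR.
  over.
rewrite mulr_natl -sumr_const_nat.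
by rewrite (@big_geq_mkord _ _ _ i n xpredT).
Qed.

End PermAverage.

(** * Variance of sampling without replacement *)

Section PermVariance.
Context {R : realType} {n d : nat}.

Lemma sum_perm (V : nmodType) (F : 'I_n -> V) (s : 'S_n) :
  \sum_j F (s j) = \sum_r F r.
Proof. by rewrite [RHS](reindex_inj (@perm_inj _ s)). Qed.

(* For distinct positions, E<g (s j), g (s l)> = - E|g (s j)|^2 / (n - 1), since
   the values g (s l) sum up to 0. *)
Lemma savg_weighted_sum (g : 'I_n -> 'rV[R]_d) (V : R) (c : 'I_n -> R) :
  (1 < n)%N -> \sum_r g r = 0 -> (forall r, enorm (g r) ^+ 2 <= V) ->
  savg (fun s => enorm (\sum_j c j *: g (s j)) ^+ 2) <= 2 * V * \sum_j c j ^+ 2.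
Proof.
move=> n1 g0 gV.
pose w j l := savg (fun s : 'S_n => edot (g (s j)) (g (s l))).
have wsum j : \sum_l w j l = 0.
  rewrite -[RHS](@savg_cst R n) /w -savg_sum; apply: eq_savg => s.
  by rewrite /= -edot_sumr sum_perm g0 edotC edot0l.
have wex j l l' : l != j -> l' != j -> w j l = w j l'.
  move=> lj l'j; rewrite /w -(savg_reindex (tperm l l')); apply: eq_savg => s.
  by rewrite !permM tpermL tpermD.
have wdiag j l : w j j = w l l.
  rewrite /w -(savg_reindex (tperm j l)); apply: eq_savg => s.
  by rewrite !permM tpermL.
pose j0 : 'I_n := Ordinal (ltnW n1); pose A := w j0 j0.
have A0 : 0 <= A by apply: savg_ge0 => s; exact: edot_ge0.
have AV : A <= V.
  by rewrite -(@savg_cst R n V); apply: ler_savg => s; rewrite -enorm_sqr.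
have N1 : 1 <= n%:R - 1 :> R by rewrite lerBrDr -(natrD _ 1 1) ler_nat.
have woff j l : l != j -> w j l = - (A / (n%:R - 1)).
  move=> lj; have := wsum j; rewrite (bigD1 j) //= (wdiag j j0) -/A.
  rewrite (eq_bigr (fun=> w j l)); last by move=> k kj; exact: wex.
  rewrite sumr_const cardC1 card_ord -[X in _ + X = _]mulr_natl -subn1 natrB ?(ltnW n1) //.
  move=> h; have n0 : n%:R - 1 != 0 :> R by rewrite gt_eqF // (lt_le_trans ltr01).
  apply: (mulfI n0); rewrite mulrN (mulrC _ (A / _)) divfK //; lra.
rewrite (@eq_savg _ _ _ (fun s : 'S_n =>
    \sum_j \sum_l c j * c l * edot (g (s j)) (g (s l)))); last first.
  move=> s; rewrite enorm_sqr edot_suml; apply: eq_bigr => j _.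
  rewrite edot_sumr; apply: eq_bigr => l _.
  by rewrite edotZl edotZr mulrA.
rewrite savg_sum.
(* The off-diagonal value is put everywhere and corrected on the diagonal; the double sum then
   becomes a nonpositive multiple of the square of the sum of [c], plus a multiple of the sum of
   squares. *)
have -> : \sum_j savg (fun s : 'S_n => \sum_l c j * c l * edot (g (s j)) (g (s l))) =
    \sum_j \sum_l (c j * c l * - (A / (n%:R - 1)) +
       (if l == j then c j ^+ 2 * (A + A / (n%:R - 1)) else 0)).
  apply: eq_bigr => j _; rewrite savg_sum; apply: eq_bigr => l _.
  rewrite savgZ -/(w j l); case: eqVneq => [->|/woff ->]; last by rewrite addr0.
  by rewrite (wdiag j j0) -/A; ring.
have -> : \sum_j \sum_l (c j * c l * - (A / (n%:R - 1)) +
       (if l == j then c j ^+ 2 * (A + A / (n%:R - 1)) else 0)) =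
    (\sum_j c j) ^+ 2 * - (A / (n%:R - 1)) +
    (\sum_j c j ^+ 2) * (A + A / (n%:R - 1)).
  under eq_bigr do rewrite big_split /= -big_mkcond big_pred1_eq -mulr_suml -mulr_sumr.
  by rewrite big_split /= -!mulr_suml expr2.
have C0 : 0 <= \sum_j c j ^+ 2 by apply: sumr_ge0 => j _; exact: sqr_ge0.
have C1 : 0 <= (\sum_j c j) ^+ 2 by exact: sqr_ge0.
have A1 : 0 <= A / (n%:R - 1) by rewrite divr_ge0 // (le_trans ler01).
(* As n >= 2, the diagonal correction A + A / (n - 1) is at most 2 A: the factor 2 of the
   statement. *)
have A2 : A / (n%:R - 1) <= A.
  by rewrite ler_pdivrMr ?(lt_le_trans ltr01) // ler_peMr.
have h1 := mulr_ge0 C1 A1.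
have h2 : (\sum_j c j ^+ 2) * (A + A / (n%:R - 1)) <= (\sum_j c j ^+ 2) * (2 * V).
  by rewrite ler_wpM2l //; lra.
lra.
Qed.

End PermVariance.

(** From expR (- x) >= 1 - x >= 1/2. *)
Lemma expR_le2 (R : realType) (x : R) : x <= 1 / 2 -> expR x <= 2.
Proof.
move=> x2; have := expR_ge1Dx (- x); rewrite expRN => h.
rewrite -[leRHS]invrK -[leLHS]invrK lef_pV2 ?posrE ?invr_gt0 ?expR_gt0 //; lra.
Qed.

(** At scale [s], an exponent between 0 and 2 is dominated by 1 plus the square. Fractional moments
    thus follow from second moments, with [s] chosen as the typical size of [z]. *)
Lemma powR_interp (R : realType) (z s nu : R) : 0 <= z -> 0 < s -> 0 <= nu <= 1 ->
  z `^ (1 + nu) <= s `^ (1 + nu) * (1 + z ^+ 2 / s ^+ 2).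
Proof.
move=> z0 s0 /andP[nu0 nu1].
have -> : z ^+ 2 / s ^+ 2 = (z / s) ^+ 2 by rewrite exprMn exprVn.
have w0 : 0 <= z / s by rewrite divr_ge0 // ltW.
have {1}-> : z = s * (z / s) by rewrite mulrC divfK // gt_eqF.
rewrite powRM ?(ltW s0) // ler_wpM2l ?powR_ge0 //.
have p0 : 0 <= 1 + nu by rewrite addr_ge0.
have [w1|w1] := leP (z / s) 1.
  apply: (@le_trans _ _ 1); last by rewrite lerDl sqr_ge0.
  have : (z / s) `^ (1 + nu) <= 1 `^ (1 + nu) by rewrite ge0_ler_powR // nnegrE.
  by rewrite powR1.
apply: (@le_trans _ _ ((z / s) ^+ 2)); last by rewrite lerDr.
rewrite -powR_mulrn // ler_powR //; first exact: ltW.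
by move: nu1; lra.
Qed.

(** * One epoch *)

Section Epoch.
Context {R : realType} {n d : nat}.
Variables (f : 'I_n -> 'rV[R]_d -> R) (L mu G : R) (xs : 'rV[R]_d).
Variable (X : set 'rV[R]_d).

Local Notation g r x := (grad (f r) x).
Local Notation N := (n%:R : R).

Hypothesis mu_gt0 : 0 < mu.
Hypothesis mu_le_L : mu <= L.
Hypothesis monotone : forall x,
  N * mu * enorm (x - xs) ^+ 2 <= edot (x - xs) (\sum_r g r x).
Hypothesis n_gt1 : (1 < n)%N.
Hypothesis L_gt0 : 0 < L.
Hypothesis lip : forall r, lipschitz_gradient L (f r).
Hypothesis grad_sum : \sum_r g r xs = 0.
Hypothesis Xxs : X xs.
Hypothesis grad_bound : forall r x, X x -> enorm (g r x) <= G.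

Let N_gt0 : 0 < N. Proof. by rewrite ltr0n ltnW. Qed.
Let L_ge0 : 0 <= L. Proof. exact: ltW. Qed.
Let r0 : 'I_n := Ordinal (ltnW n_gt1).

Let G_ge0 : 0 <= G.
Proof. by apply: le_trans (enorm_ge0 _) (@grad_bound r0 _ Xxs). Qed.

Lemma rr_epochS eta s y (i : 'I_n) :
  rr_epoch f eta s y i.+1 =
  rr_epoch f eta s y i - eta i.+1 *: grad (f (s i)) (rr_epoch f eta s y i).
Proof. by rewrite /= valK. Qed.

Let rr_epoch_step eta s y i (iln : (i < n)%N) :
  rr_epoch f eta s y i.+1 =
  rr_epoch f eta s y i -
    eta i.+1 *: grad (f (s (Ordinal iln))) (rr_epoch f eta s y i).
Proof. exact: (rr_epochS eta s y (Ordinal iln)). Qed.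

Lemma rr_epoch_sum eta s y m i : (m <= i <= n)%N ->
  rr_epoch f eta s y i - rr_epoch f eta s y m =
  - \sum_(j < n | (m <= j < i)%N)
      eta j.+1 *: grad (f (s j)) (rr_epoch f eta s y j).
Proof.
elim: i => [|i IH] /andP[mi iln].
  move: mi; rewrite leqn0 => /eqP ->.
  by rewrite subrr big_pred0 ?oppr0 // => j; rewrite ltn0 andbF.
move: mi; rewrite leq_eqVlt => /predU1P[->|mi].
  by rewrite subrr big_pred0 ?oppr0 // => j; rewrite leqNgt andNb.
rewrite (@big_ord_rangeS _ n m (Ordinal iln)) //.
rewrite rr_epoch_step [RHS]opprD -IH; last by rewrite -ltnS mi ltnW.
by rewrite addrAC.
Qed.

(** This replaces adaptedness to a filtration: only the values of [s] at positions before [i]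
    influence the iterate. *)
Lemma eq_rr_epoch eta (s s' : 'S_n) y i : (i <= n)%N ->
  (forall j : 'I_n, (j < i)%N -> s j = s' j) ->
  rr_epoch f eta s y i = rr_epoch f eta s' y i.
Proof.
elim: i => // i IH iln h.
have E : rr_epoch f eta s y i = rr_epoch f eta s' y i.
  apply: IH => [|j ji]; first exact: ltnW.
  by apply: h; rewrite ltnS ltnW.
by rewrite (rr_epoch_step eta s y iln) (rr_epoch_step eta s' y iln) E h.
Qed.

Lemma rr_epoch_tperm eta s y (i t : 'I_n) : (i <= t)%N ->
  rr_epoch f eta (tperm i t * s)%g y i = rr_epoch f eta s y i.
Proof.
move=> it; apply: eq_rr_epoch; first exact: ltnW.
move=> j ji; rewrite permM tpermD // -val_eqE /= gtn_eqF //.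
exact: leq_trans ji it.
Qed.

(** The gradients at [xs] sum to 0, so their partial sums are of order sqrt(n) in mean square,
    against n for the triangle inequality. *)
Lemma savg_grad_sum (c : 'I_n -> R) (h : R) : (forall j, 0 <= c j <= h) ->
  savg (fun s : 'S_n => enorm (\sum_j c j *: grad (f (s j)) xs) ^+ 2) <=
  2 * G ^+ 2 * (N * h ^+ 2).
Proof.
move=> ch.
apply: le_trans (@savg_weighted_sum _ _ _ (fun r => grad (f r) xs) (G ^+ 2) _ _ _ _) _.
- by [].
- exact: grad_sum.
- by move=> r; rewrite lerXn2r ?nnegrE ?enorm_ge0 //; exact: grad_bound.
rewrite ler_wpM2l ?mulr_ge0 ?sqr_ge0 //.
apply: (@le_trans _ _ (\sum_(j < n) h ^+ 2)).
  apply: ler_sum => j _; have /andP[c0 cjh] := ch j.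
  by rewrite lerXn2r ?nnegrE // (le_trans c0).
by rewrite sumr_const card_ord mulr_natl.
Qed.

(** Each gradient is split into its value at [xs], whose weighted sum is controlled only on average,
    and a Lipschitz difference, controlled for each permutation by the earlier displacements;
    Gronwall closes the loop. The free starting position [m] serves the tail of epoch 0. *)
Lemma epoch_drift eta y (h : R) m : 0 <= h ->
  (forall j, (m <= j < n)%N -> 0 <= eta j.+1 <= h) ->
  forall i, (m <= i <= n)%N ->
  savg (fun s => enorm (rr_epoch f eta s y i - rr_epoch f eta s y m) ^+ 2) <=
  (4 * h ^+ 2 * N * G ^+ 2
   + 4 * (h * L * N) ^+ 2 * savg (fun s => enorm (rr_epoch f eta s y m - xs) ^+ 2))
  * expR (4 * (h * L * N) ^+ 2).
Proof.
move=> h0 eh; set am := savg (fun s => enorm (rr_epoch f eta s y m - xs) ^+ 2).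
have am0 : 0 <= am by apply: savg_ge0 => s; exact: sqr_ge0.
have -> : 4 * (h * L * N) ^+ 2 = 4 * N * (h * L) ^+ 2 * N by ring.
apply: discrete_gronwall.
- by rewrite addr_ge0 // !mulr_ge0 ?sqr_ge0.
- by rewrite !mulr_ge0 ?sqr_ge0.
move=> i mi; rewrite -savg_sum -savgZ.
(* Weight 0 outside the range turns the partial sum into a full one, as [savg_grad_sum] requires. *)
pose c (j : 'I_n) := if (m <= j < i)%N then eta j.+1 else 0.
have hc j : 0 <= c j <= h.
  rewrite /c; case: ifP => [/andP[mj ji]|_]; last by rewrite lexx h0.
  by apply: eh; rewrite mj ltn_ord.
have hW := savg_grad_sum hc.
apply: (@le_trans _ _ (savg (fun s =>
   2 * enorm (\sum_j c j *: grad (f (s j)) xs) ^+ 2 +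
   (4 * N * (h * L) ^+ 2 * N * enorm (rr_epoch f eta s y m - xs) ^+ 2 +
    4 * N * (h * L) ^+ 2 * \sum_(j < n | (m <= j < i)%N)
      enorm (rr_epoch f eta s y j - rr_epoch f eta s y m) ^+ 2)))); last first.
  rewrite !savgD !savgZ -/am; lra.
apply: ler_savg => s; rewrite rr_epoch_sum // enormN.
set x := rr_epoch f eta s y.
have -> : \sum_(j < n | (m <= j < i)%N) eta j.+1 *: grad (f (s j)) (x j) =
  \sum_j c j *: grad (f (s j)) xs + \sum_(j < n | (m <= j < i)%N)
     eta j.+1 *: (grad (f (s j)) (x j) - grad (f (s j)) xs).
  rewrite [\sum_j c j *: _](_ : _ = \sum_(j < n | (m <= j < i)%N)
     eta j.+1 *: grad (f (s j)) xs).
    rewrite -big_split /=; apply: eq_bigr => j _.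
    by rewrite -scalerDr addrC subrK.
  rewrite [RHS]big_mkcond; apply: eq_bigr => j _; rewrite /c.
  by case: ifP => // _; rewrite scale0r.
apply: le_trans (enormD_sqr _ _) _; rewrite lerD2l.
apply: le_trans (ler_wpM2l _ (enorm_sum_sqr _ _)) _ => //.
have hj (j : 'I_n) : (m <= j < i)%N ->
    enorm (eta j.+1 *: (grad (f (s j)) (x j) - grad (f (s j)) xs)) ^+ 2 <=
    (h * L) ^+ 2 * 2 * (enorm (x m - xs) ^+ 2 + enorm (x j - x m) ^+ 2).
  move=> /andP[mj ji]; have /andP[e0 ej] := eh j (introT andP (conj mj (ltn_ord j))).
  rewrite enormZ ger0_norm //.
  apply: (@le_trans _ _ ((h * L * enorm (x j - xs)) ^+ 2)).
    rewrite lerXn2r ?nnegrE ?mulr_ge0 ?enorm_ge0 ?(ltW L_gt0) //.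
    by rewrite -mulrA ler_pM ?enorm_ge0 // lip.
  rewrite exprMn -(mulrA _ 2) ler_wpM2l ?sqr_ge0 // mulrDr.
  have -> : x j - xs = (x m - xs) + (x j - x m) by rewrite [RHS]addrC addrA subrK.
  exact: enormD_sqr.
apply: le_trans (ler_wpM2l _ (ler_wpM2l _ (ler_sum _ hj))) _ => //.
rewrite -mulr_sumr big_split /=.
have hs : \sum_(j < n | (m <= j < i)%N) enorm (x m - xs) ^+ 2 <= N * enorm (x m - xs) ^+ 2.
  have -> : N * enorm (x m - xs) ^+ 2 = \sum_(j < n) enorm (x m - xs) ^+ 2.
    by rewrite sumr_const card_ord mulr_natl.
  rewrite [leRHS](bigID (fun j : 'I_n => (m <= j < i)%N)) /=.
  by rewrite lerDl; apply: sumr_ge0 => j _; exact: sqr_ge0.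
have k0 : 0 <= 4 * N * (h * L) ^+ 2 by rewrite !mulr_ge0 ?sqr_ge0.
have := ler_wpM2l k0 hs. lra.
Qed.

(* While i <= n mu / (2 L), the average of the remaining components still
   inherits half of the strong monotonicity of the full average. *)
Lemma epoch_early_step eta y (i : 'I_n) :
  (forall s, X (rr_epoch f eta s y i)) -> 0 <= eta i.+1 ->
  i%:R * L <= N * mu / 2 ->
  savg (fun s => enorm (rr_epoch f eta s y i.+1 - xs) ^+ 2) <=
  (1 - eta i.+1 * mu / 2) * savg (fun s => enorm (rr_epoch f eta s y i - xs) ^+ 2)
  + 8 * eta i.+1 * G ^+ 2 / (N * mu) + eta i.+1 ^+ 2 * G ^+ 2.
Proof.
move=> hX e0 iL; pose x s := rr_epoch f eta s y i; set e := eta i.+1.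
pose phi s r := edot (x s - xs) (grad (f r) (x s)).
pose a := savg (fun s => enorm (x s - xs) ^+ 2).
pose Z := savg (fun s => phi s (s i)).
rewrite -[savg (fun s => enorm (rr_epoch f eta s y i - xs) ^+ 2)]/a -/e.
have Nmu : 0 < N * mu by exact: mulr_gt0.
have niE : (n - i)%:R = N - i%:R :> R by rewrite natrB // ltnW.
(* At least half of the components are still to be drawn, because mu <= L; dividing by [n - i]
   therefore costs only a constant. *)
have iN : i%:R <= N / 2 :> R.
  rewrite -(ler_pM2r L_gt0) (le_trans iL) // mulrAC.
  by rewrite ler_wpM2l // divr_ge0.
have hZ : mu / 4 * a - 4 * G ^+ 2 / (N * mu) <= Z.
  have ni0 : 0 < (n - i)%:R :> R by rewrite ltr0n subn_gt0.
  rewrite -(ler_pM2l ni0) -(@savg_remaining _ _ i phi); last first.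
    by move=> t s r it; rewrite /phi /x rr_epoch_tperm.
  pose c (j : 'I_n) : R := if (j < i)%N then 1 else 0.
  have hc j : 0 <= c j <= 1 by rewrite /c; case: ifP; rewrite ?lexx ler01.
  have := savg_grad_sum hc; rewrite expr1n mulr1 => hW.
  apply: (@le_trans _ _ (savg (fun s => N * mu / 4 * enorm (x s - xs) ^+ 2 +
     - (N * mu)^-1 * enorm (\sum_(j < n) c j *:
         grad (f (s j)) xs) ^+ 2))).
    rewrite savgD !savgZ -/a.
    have : (N * mu)^-1 * savg (fun s : 'S_n => enorm (\sum_(j < n) c j *: grad (f (s j)) xs) ^+ 2) <=
       (N * mu)^-1 * (2 * G ^+ 2 * N).
      by rewrite ler_wpM2l ?invr_ge0 ?(ltW Nmu).
    have -> : (N * mu)^-1 * (2 * G ^+ 2 * N) = N / 2 * (4 * G ^+ 2 / (N * mu)).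
      by field; rewrite !gt_eqF.
    have a0 : 0 <= a by apply: savg_ge0 => s; exact: sqr_ge0.
    have c0 : 0 <= 4 * G ^+ 2 / (N * mu).
      by rewrite divr_ge0 ?(ltW Nmu) // mulr_ge0 // sqr_ge0.
    have i0 : 0 <= i%:R :> R by [].
    have k1 : 0 <= (N / 2 - i%:R) * (4 * G ^+ 2 / (N * mu)).
      by rewrite mulr_ge0 // subr_ge0.
    have k2 : 0 <= i%:R * (mu / 4 * a) by rewrite !mulr_ge0 // ltW.
    rewrite niE; lra.
  apply: ler_savg => s; set S := \sum_(j < n) _.
  have -> : \sum_(t < n | (i <= t)%N) phi s (s t) =
     edot (x s - xs) (\sum_r grad (f r) (x s)) -
     \sum_(t < n | (t < i)%N) phi s (s t).
    rewrite edot_sumr -(sum_perm (fun r => phi s r) s).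
    rewrite [X in _ = X - _](bigID (fun t : 'I_n => (t < i)%N)) /=.
    rewrite addrAC subrr add0r.
    by apply: eq_bigl => t; rewrite -leqNgt.
  (* Budget: of n mu, the drawn components take up to i L <= n mu / 2 by the Lipschitz bound,
     Young's inequality for the noise sum [S] takes n mu / 4, and n mu / 4 is left. *)
  have h1 := monotone (x s).
  have h2 : \sum_(t < n | (t < i)%N) phi s (s t) <=
      i%:R * (L * enorm (x s - xs) ^+ 2) + edot (x s - xs) S.
    rewrite /S edot_sumr.
    have -> : \sum_(t < n) edot (x s - xs)
        (c t *: grad (f (s t)) xs) =
        \sum_(t < n | (t < i)%N) edot (x s - xs) (grad (f (s t)) xs).
      rewrite [RHS]big_mkcond; apply: eq_bigr => t _; rewrite /c.
      by case: ifP; rewrite ?scale1r // scale0r edotC edot0l.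
    rewrite -lerBlDr -sumrB.
    have -> : i%:R * (L * enorm (x s - xs) ^+ 2) =
        \sum_(t < n | (t < i)%N) L * enorm (x s - xs) ^+ 2.
      by rewrite (big_ord_narrow (ltnW (ltn_ord i))) /= sumr_const card_ord mulr_natl.
    apply: ler_sum => t _; rewrite -edotNr -edotDr.
    apply: le_trans (edot_le _ _) _.
    by rewrite mulrC expr2 mulrA ler_wpM2r ?enorm_ge0 // lip.
  have h3 : edot (x s - xs) S <=
      N * mu / 4 * enorm (x s - xs) ^+ 2 + (N * mu)^-1 * enorm S ^+ 2.
    apply: le_trans (edot_le _ _) _.
    have := sqr_ge0 (N * mu / 2 * enorm (x s - xs) - enorm S) => h.
    rewrite -(ler_pM2l Nmu) [leRHS]mulrDr (mulrA _ _^-1) mulfV ?gt_eqF // mul1r.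
    lra.
  have h4 : i%:R * (L * enorm (x s - xs) ^+ 2) <=
     N * mu / 2 * enorm (x s - xs) ^+ 2.
    by rewrite mulrA ler_wpM2r ?sqr_ge0.
  lra.
apply: (@le_trans _ _ (savg (fun s => enorm (x s - xs) ^+ 2 +
    (- (2 * e) * phi s (s i) + e ^+ 2 * G ^+ 2)))).
  apply: ler_savg => s; rewrite rr_epochS -/e -/(x s).
  have -> : enorm (x s - e *: grad (f (s i)) (x s) - xs) ^+ 2 =
     enorm (x s - xs) ^+ 2 + (- (2 * e) * phi s (s i) +
       e ^+ 2 * enorm (grad (f (s i)) (x s)) ^+ 2).
    rewrite addrAC !enorm_sqr /phi.
    move: (x s - xs) (grad (f (s i)) (x s)) => v u.
    by rewrite !edotE (edotC u v); ring.
  rewrite !lerD2l ler_wpM2l ?sqr_ge0 // lerXn2r ?nnegrE ?enorm_ge0 //.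
  by apply: grad_bound; exact: hX.
rewrite !savgD (savgZ (- (2 * e))) savg_cst -/a -/Z.
have -> : 8 * e * G ^+ 2 / (N * mu) = 2 * e * (4 * G ^+ 2 / (N * mu)).
  by field; rewrite !gt_eqF.
have := ler_wpM2l e0 hZ; rewrite -/e. lra.
Qed.

Lemma dist_bound x : X x -> enorm (x - xs) <= G / mu.
Proof.
move=> Xx; have [->|e0] := eqVneq (enorm (x - xs)) 0.
  by rewrite divr_ge0 // ltW.
have ep : 0 < enorm (x - xs) by rewrite lt_def e0 enorm_ge0.
have h : edot (x - xs) (\sum_r grad (f r) x) <= enorm (x - xs) * (N * G).
  apply: le_trans (edot_le _ _) _; rewrite ler_wpM2l ?enorm_ge0 //.
  apply: le_trans (enorm_sum _ _ _) _.
  have -> : N * G = \sum_(r < n) G by rewrite sumr_const card_ord mulr_natl.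
  by apply: ler_sum => r _; exact: grad_bound.
rewrite ler_pdivlMr // -(ler_pM2l (mulr_gt0 ep N_gt0)).
by have := le_trans (monotone x) h; lra.
Qed.

Lemma epoch_tail eta y (h t : R) m : (m <= n)%N -> 0 <= h -> h * L * N = t ->
  (forall j, (m <= j < n)%N -> 0 <= eta j.+1 <= h) ->
  savg (fun s => enorm (rr_epoch f eta s y n - xs) ^+ 2) <=
  2 * savg (fun s => enorm (rr_epoch f eta s y m - xs) ^+ 2) +
  2 * ((4 * h ^+ 2 * N * G ^+ 2
   + 4 * t ^+ 2 * savg (fun s => enorm (rr_epoch f eta s y m - xs) ^+ 2))
  * expR (4 * t ^+ 2)).
Proof.
move=> mn h0 <- eh; have := @epoch_drift eta y h m h0 eh n; rewrite mn leqnn.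
move=> /(_ isT) hd.
apply: (@le_trans _ _ (savg (fun s =>
   2 * enorm (rr_epoch f eta s y m - xs) ^+ 2 +
   2 * enorm (rr_epoch f eta s y n - rr_epoch f eta s y m) ^+ 2))).
  apply: ler_savg => s.
  have -> : rr_epoch f eta s y n - xs = (rr_epoch f eta s y m - xs) +
    (rr_epoch f eta s y n - rr_epoch f eta s y m).
    by rewrite [RHS]addrC addrA subrK.
  exact: enormD_sqr.
by rewrite savgD !savgZ lerD2l ler_wpM2l.
Qed.

(** The usual SGD induction for steps c / p with p = q + i: as c mu >= 8, the contraction 1 - 4 / p
    beats the decay of 1 / p and leaves room for noise of order 1 / p^2. The three summands of the
    numerator pay for the cross noise, the squared step and the initial distance. *)
Lemma epoch_early eta y (c q : R) m :
  (forall s i, (i <= n)%N -> X (rr_epoch f eta s y i)) ->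
  (forall i, eta i.+1 = c / (q + i.+1%:R)) -> 8 <= c * mu -> 4 <= q ->
  (m <= n)%N -> m%:R * L <= N * mu / 2 ->
  forall i, (i <= m)%N ->
  savg (fun s => enorm (rr_epoch f eta s y i - xs) ^+ 2) <=
  (8 * c * G ^+ 2 * (q + 1) / mu + c ^+ 2 * G ^+ 2 + q * (G / mu) ^+ 2) / (q + i%:R).
Proof.
move=> hX he cmu q4 mn mL; set W := _ + q * _ => i.
have c0 : 0 < c by rewrite -(pmulr_lgt0 _ mu_gt0) (lt_le_trans _ cmu).
have q0 : 0 < q by exact: lt_le_trans q4.
have N1 : 1 <= N by rewrite ler1n ltnW.
have E1 : 0 <= 8 * c * G ^+ 2 * (q + 1) / mu.
  by rewrite !mulr_ge0 ?sqr_ge0 ?invr_ge0 ?addr_ge0 // ltW.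
have E2 : 0 <= c ^+ 2 * G ^+ 2 by rewrite mulr_ge0 ?sqr_ge0.
have E3 : 0 <= q * (G / mu) ^+ 2 by rewrite mulr_ge0 ?sqr_ge0 ?ltW.
elim: i => [_|i IH im].
  rewrite addr0 ler_pdivlMr //.
  apply: (@le_trans _ _ ((G / mu) ^+ 2 * q)); last by rewrite /W; lra.
  rewrite ler_wpM2r ?(ltW q0) // -(@savg_cst _ n ((G / mu) ^+ 2)).
  apply: ler_savg => s /=.
  rewrite lerXn2r ?nnegrE ?enorm_ge0 ?divr_ge0 ?(ltW mu_gt0) //.
  by apply: dist_bound; exact: (hX s 0%N).
have iln : (i < n)%N := leq_trans im mn.
have {}IH := IH (ltnW im).
have p0 : 0 < q + i.+1%:R by rewrite ltr_wpDr.
have ep : 0 < eta i.+1 by rewrite he divr_gt0.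
have iL : i%:R * L <= N * mu / 2.
  apply: le_trans mL; rewrite ler_wpM2r // ler_nat; exact: ltnW.
have hs := @epoch_early_step eta y (Ordinal iln) (fun s => hX s i (ltnW iln))
   (ltW ep) iL.
apply: le_trans hs _ => /=.
set a := savg _ in IH *.
rewrite he; set p := q + i.+1%:R in p0 *.
have pE : q + i%:R = p - 1 by rewrite /p -natr1; ring.
rewrite pE in IH.
have p5 : 5 <= p.
  have : 0 <= i%:R :> R by []. 
  by rewrite /p -natr1; lra.
(* Within epoch 0 the cross noise, of order 1 / (p n), is thereby of order 1 / p^2. *)
have pN : p <= N * (q + 1).
  have : i.+1%:R <= N by rewrite ler_nat.
  have : q <= N * q by rewrite ler_peMl // ltW.
  by rewrite /p; lra.
have a0 : 0 <= a by apply: savg_ge0 => s; exact: sqr_ge0.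
have t1 : (1 - c / p * mu / 2) * a <= (1 - 4 / p) * (W / (p - 1)).
  apply: (@le_trans _ _ ((1 - 4 / p) * a)).
    rewrite ler_wpM2r // lerD2l lerN2.
    have -> : c / p * mu / 2 = c * mu / 2 / p by ring.
    by rewrite ler_wpM2r ?invr_ge0 ?(ltW p0) //; lra.
  by rewrite ler_wpM2l // subr_ge0 ler_pdivrMr // mul1r; lra.
have t2 : 8 * (c / p) * G ^+ 2 / (N * mu) <= 8 * c * G ^+ 2 * (q + 1) / mu / p ^+ 2.
  have -> : 8 * (c / p) * G ^+ 2 / (N * mu) = (8 * c * G ^+ 2 / mu / p ^+ 2) * (p / N).
    by field; rewrite !gt_eqF.
  have -> : 8 * c * G ^+ 2 * (q + 1) / mu / p ^+ 2 =
     (8 * c * G ^+ 2 / mu / p ^+ 2) * (q + 1) by ring.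
  rewrite ler_wpM2l //; last by rewrite ler_pdivrMr // mulrC.
  by rewrite !mulr_ge0 ?sqr_ge0 ?invr_ge0 ?exprn_ge0 // ltW.
have t3 : (c / p) ^+ 2 * G ^+ 2 = c ^+ 2 * G ^+ 2 / p ^+ 2.
  by field; rewrite gt_eqF.
have W0 : 0 <= W by rewrite /W; lra.
have t4 : (1 - 4 / p) * (W / (p - 1)) + W / p ^+ 2 <= W / p.
  have -> : W / p = (1 - 4 / p) * (W / (p - 1)) + W / p ^+ 2 +
     W * (2 * p + 1) / (p ^+ 2 * (p - 1)).
    by field; rewrite !gt_eqF //; lra.
  rewrite lerDl !mulr_ge0 ?invr_ge0 ?mulr_ge0 ?exprn_ge0 //; lra.
have t5 : 8 * c * G ^+ 2 * (q + 1) / mu / p ^+ 2 + c ^+ 2 * G ^+ 2 / p ^+ 2 <= W / p ^+ 2.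
  by rewrite -mulrDl ler_wpM2r ?invr_ge0 ?exprn_ge0 ?(ltW p0) // /W; lra.
rewrite t3; lra.
Qed.

(** [n] times the bound of [epoch_tail] with h = k c / n: [W] is the numerator from [epoch_early],
    and 1 / k the fraction of the epoch covered by it. *)
Definition first_epoch_const (c q : R) : R :=
  let k := 2 * L / mu in
  let W := 8 * c * G ^+ 2 * (q + 1) / mu + c ^+ 2 * G ^+ 2 + q * (G / mu) ^+ 2 in
  2 * (k * W) + 2 * ((4 * (k * c) ^+ 2 * G ^+ 2 + 4 * (k * c * L) ^+ 2 * (k * W))
    * expR (4 * (k * c * L) ^+ 2)).

(* The factor n mu / (2 L) bounds the number of steps covered by [epoch_early];
   over the rest of the epoch the steps are O(1 / n). *)
Lemma first_epoch eta y (c q : R) :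
  (forall s i, (i <= n)%N -> X (rr_epoch f eta s y i)) ->
  (forall i, eta i.+1 = c / (q + i.+1%:R)) -> 8 <= c * mu -> 4 <= q ->
  savg (fun s => enorm (rr_epoch f eta s y n - xs) ^+ 2) <=
  first_epoch_const c q / N.
Proof.
move=> hX he cmu q4; rewrite /first_epoch_const; set k := 2 * L / mu.
set W := _ + q * _.
have c0 : 0 < c by rewrite -(pmulr_lgt0 _ mu_gt0) (lt_le_trans _ cmu).
have k0 : 0 < k by rewrite !mulr_gt0 // invr_gt0.
have Nk0 : 0 <= N / k by rewrite divr_ge0 // ltW.
pose m := Num.truncn (N / k).
have /andP[m1 m2] : m%:R <= N / k < m.+1%:R by exact: truncn_itv.
have mL : m%:R * L <= N * mu / 2.
  have -> : N * mu / 2 = N / k * L by rewrite /k; field; rewrite !gt_eqF.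
  by rewrite ler_wpM2r.
have mn : (m <= n)%N.
  rewrite -(ler_nat R); apply: le_trans m1 _.
  rewrite ler_pdivrMr // ler_peMr // /k ler_pdivlMr // mul1r.
  by move: mu_le_L L_ge0; lra.
(* The offset [q] makes up for the rounding in [m], so beyond [m] the steps are at most k c / n. *)
have qm : N / k <= q + m%:R by move: m2; rewrite -natr1; lra.
have qm0 : 0 < q + m%:R by rewrite ltr_wpDr // (lt_le_trans _ q4).
have W0 : 0 <= W.
  have q0 : 0 < q by exact: lt_le_trans q4.
  have E1 : 0 <= 8 * c * G ^+ 2 * (q + 1) / mu.
    by rewrite !mulr_ge0 ?sqr_ge0 ?invr_ge0 ?addr_ge0 // ltW.
  have E2 : 0 <= c ^+ 2 * G ^+ 2 by rewrite mulr_ge0 ?sqr_ge0.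
  have E3 : 0 <= q * (G / mu) ^+ 2 by rewrite mulr_ge0 ?sqr_ge0 ?ltW.
  by rewrite /W; lra.
have := @epoch_early eta y c q m hX he cmu q4 mn mL m (leqnn m).
set a := savg _; rewrite -/W => ha.
have Nk1 : 0 < N / k by rewrite divr_gt0.
have {}ha : a <= k * W / N.
  apply: le_trans ha _; rewrite ler_pdivrMr //.
  have -> : k * W / N * (q + m%:R) = W * ((q + m%:R) / (N / k)).
    by field; rewrite !gt_eqF.
  by rewrite ler_peMr // ler_pdivlMr // mul1r.
have h0 : 0 <= k * c / N by rewrite !mulr_ge0 ?invr_ge0 // ltW.
have := @epoch_tail eta y (k * c / N) (k * c * L) m mn h0.
rewrite -/a => /(_ _ _)/le_trans; apply.
- by field; rewrite gt_eqF.
- move=> j /andP[mj jn]; rewrite he.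
  have pj : q + m%:R <= q + j.+1%:R by rewrite lerD2l ler_nat ltnW.
  have pj0 := lt_le_trans qm0 pj.
  rewrite divr_ge0 ?(ltW c0) ?(ltW pj0) //= ler_pdivrMr //.
  have -> : k * c / N * (q + j.+1%:R) = c * ((q + j.+1%:R) / (N / k)).
    by field; rewrite !gt_eqF.
  by rewrite ler_peMr ?(ltW c0) // ler_pdivlMr // mul1r (le_trans qm).
have x0 : 0 <= expR (4 * (k * c * L) ^+ 2) by exact: expR_ge0.
have t0 : 0 <= 4 * (k * c * L) ^+ 2 by rewrite mulr_ge0 ?sqr_ge0.
have -> : 4 * (k * c / N) ^+ 2 * N * G ^+ 2 = 4 * (k * c) ^+ 2 * G ^+ 2 / N.
  by field; rewrite gt_eqF.
have Ea := ler_wpM2l t0 ha.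
rewrite [leRHS]mulrDl lerD //; first by move: ha; lra.
rewrite -[leRHS]mulrA ler_wpM2l // [leRHS]mulrAC ler_wpM2r //; move: Ea; lra.
Qed.

Definition crude_const (c : R) : R :=
  2 + 8 * (c ^+ 2 * G ^+ 2 + (c * L) ^+ 2) * expR (4 * (c * L) ^+ 2).

(** For epochs in which e n is bounded but not yet small: no contraction, but a growth factor
    independent of [n]. *)
Lemma crude_epoch eta y (c e : R) : 0 <= e -> e * N <= c ->
  (forall i, eta i.+1 = e) ->
  savg (fun s => enorm (rr_epoch f eta s y n - xs) ^+ 2) <=
  crude_const c * (enorm (y - xs) ^+ 2 + N^-1).
Proof.
move=> e0 eN he; rewrite /crude_const.
have c0 : 0 <= c by apply: le_trans eN; rewrite mulr_ge0.
have := @epoch_tail eta y e (e * L * N) 0%N isT e0 erefl.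
move=> /(_ _)/le_trans; apply; first by move=> j _; rewrite he e0 lexx.
have -> : savg (fun s => enorm (rr_epoch f eta s y 0 - xs) ^+ 2) = enorm (y - xs) ^+ 2.
  exact: (savg_cst (enorm (y - xs) ^+ 2)).
set a := enorm _ ^+ 2.
have a0 : 0 <= a by exact: sqr_ge0.
have h1 : e ^+ 2 * N <= c ^+ 2 / N.
  rewrite ler_pdivlMr // -mulrA -expr2 -exprMn lerXn2r ?nnegrE //.
  by rewrite mulr_ge0.
have h2 : (e * L * N) ^+ 2 <= (c * L) ^+ 2.
  by rewrite mulrAC lerXn2r ?nnegrE ?mulr_ge0 // ler_wpM2r.
have h3 : expR (4 * (e * L * N) ^+ 2) <= expR (4 * (c * L) ^+ 2).
  by rewrite ler_expR ler_wpM2l.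
have h4 : 4 * e ^+ 2 * N * G ^+ 2 + 4 * (e * L * N) ^+ 2 * a <=
   4 * (c ^+ 2 * G ^+ 2 + (c * L) ^+ 2) * (a + N^-1).
  have k1 := ler_wpM2r (sqr_ge0 G) h1; have k2 := ler_wpM2r a0 h2.
  have k3 : 0 <= c ^+ 2 * G ^+ 2 * a by rewrite !mulr_ge0 ?enorm_ge0.
  have k4 : 0 <= (c * L) ^+ 2 / N by rewrite divr_ge0 ?sqr_ge0.
  have -> : 4 * e ^+ 2 * N * G ^+ 2 = 4 * (e ^+ 2 * N * G ^+ 2) by ring.
  have : c ^+ 2 / N * G ^+ 2 = c ^+ 2 * G ^+ 2 / N by rewrite mulrAC.
  lra.
have h5 : 0 <= 4 * e ^+ 2 * N * G ^+ 2 + 4 * (e * L * N) ^+ 2 * a.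
  by rewrite addr_ge0 // !mulr_ge0 ?enorm_ge0.
have h6 := ler_pM h5 (expR_ge0 _) h4 h3.
have N0 : 0 <= N^-1 by rewrite invr_ge0.
lra.
Qed.

(** The gradient of the average, written as a sum on which permutations act directly. *)
Definition gavg x : 'rV[R]_d := N^-1 *: \sum_r grad (f r) x.

Lemma gavg_lipschitz u v : enorm (gavg u - gavg v) <= L * enorm (u - v).
Proof.
rewrite /gavg -scalerBr -sumrB enormZ ger0_norm ?invr_ge0 //.
rewrite ler_pdivrMl //; apply: le_trans (enorm_sum _ _ _) _.
have -> : N * (L * enorm (u - v)) = \sum_(r < n) L * enorm (u - v).
  by rewrite sumr_const card_ord mulr_natl.
by apply: ler_sum => r _; exact: lip.
Qed.

Lemma gavg_xs : gavg xs = 0.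
Proof. by rewrite /gavg grad_sum scaler0. Qed.

(** * Coupling and displacement in an epoch with constant step *)

Section ConstantStep.
Variables (eta : nat -> R) (e : R) (y : 'rV[R]_d).
Hypothesis etaE : forall i, eta i.+1 = e.
Hypothesis e_gt0 : 0 < e.
Hypothesis reach : forall s i, (i <= n)%N -> X (rr_epoch f eta s y i).

Local Notation x_ := (rr_epoch f eta).
Local Notation t := (e * L * N).

Hypothesis t_small : t <= 1 / 4.

Let e_ge0 : 0 <= e. Proof. exact: ltW. Qed.
Let t_ge0 : 0 <= t. Proof. by rewrite !mulr_ge0. Qed.

Let pow_le2 i : (i <= n)%N -> (1 + e * L) ^+ i <= 2.
Proof.
move=> iln; have eL : 0 <= e * L by rewrite mulr_ge0.
apply: (@le_trans _ _ (expR (e * L) ^+ i)).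
  by rewrite lerXn2r ?nnegrE ?addr_ge0 ?expR_ge0 // expR_ge1Dx.
rewrite -expRM_natl expR_le2 //; apply: (@le_trans _ _ t); last by move: t_small; lra.
by rewrite mulrC ler_wpM2l // ler_nat.
Qed.

(** The runs coincide up to step [l], separate there by at most 2 e G, and afterwards the gap grows
    by at most 1 + e L per step. Only positions before [i] are compared, so a swap of [l] and [i]
    counts as a single change. *)
Lemma epoch_stable (s s' : 'S_n) (l : 'I_n) i : (i <= n)%N ->
  (forall j : 'I_n, (j < i)%N -> j != l -> s j = s' j) ->
  enorm (x_ s y i - x_ s' y i) <=
    if (l < i)%N then 2 * e * G * (1 + e * L) ^+ i else 0.
Proof.
have eL : 0 <= e * L by rewrite mulr_ge0.
elim: i => [_ _|i IH iln h]; first by rewrite subrr enorm0.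
have {}IH := IH (ltnW iln) (fun j ji => h j (ltnW ji)).
rewrite (rr_epoch_step eta s y iln) (rr_epoch_step eta s' y iln) !etaE.
move: IH; have Xs := reach s (ltnW iln); have Xs' := reach s' (ltnW iln).
set x := x_ s y i in Xs *; set x' := x_ s' y i in Xs' * => IH.
have -> u v : x - e *: u - (x' - e *: v) = (x - x') - e *: (u - v).
  by rewrite scalerBr !opprB addrACA [RHS]addrACA (addrC (- x')).
have [li|] := eqVneq (Ordinal iln) l.
  rewrite -li /= ltnSn; move: IH; rewrite -li /= ltnn => IH.
  apply: le_trans (enormB _ _) _; rewrite enormZ ger0_norm //.
  apply: (@le_trans _ _ (0 + e * (G + G))).
    apply: lerD => //; rewrite ler_wpM2l // (le_trans (enormB _ _)) //.
    by rewrite lerD // grad_bound.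
  have k1 : 1 <= (1 + e * L) ^+ i.+1 by rewrite exprn_ege1 // lerDl.
  have k2 : 0 <= 2 * e * G by rewrite !mulr_ge0.
  have := ler_wpM2l k2 k1; lra.
move=> il; rewrite h //=.
have -> : (l < i.+1)%N = (l < i)%N.
  by rewrite ltnS leq_eqVlt eq_sym; move: il; rewrite -val_eqE /= => /negbTE ->.
apply: (@le_trans _ _ ((1 + e * L) * enorm (x - x'))).
  apply: le_trans (enormB _ _) _; rewrite enormZ ger0_norm // mulrDl mul1r lerD2l.
  by rewrite -mulrA ler_wpM2l // lip.
case: ifP IH => _ IH.
  by rewrite exprS mulrCA ler_wpM2l // addr_ge0.
have -> : enorm (x - x') = 0 by apply/eqP; rewrite eq_le IH enorm_ge0.
by rewrite mulr0.
Qed.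

(* The swap coupling: averaging over the position l holding a given component,
   the law of x_i conditioned on s i differs from the unconditioned one by the
   exchange of the positions i and l. *)
Lemma epoch_bias (i : 'I_n) :
  enorm (vavg (fun s : 'S_n => grad (f (s i)) (x_ s y i)) -
         vavg (fun s : 'S_n => gavg (x_ s y i))) <= 4 * e * L * G.
Proof.
(* The full gradient is a sum over positions [l]; reindexing by the swap of [l] and [i] makes every
   term use component [s i] and moves the swap into the iterate. *)
have E : vavg (fun s : 'S_n => gavg (x_ s y i)) = N^-1 *: \sum_(l < n)
    vavg (fun s : 'S_n => grad (f (s i)) (x_ (tperm l i * s)%g y i)).
  rewrite /gavg vavgZ -vavg_sum; congr (_ *: _).
  rewrite (@eq_vavg _ _ _ _ (fun s : 'S_n => \sum_l grad (f (s l)) (x_ s y i))); last first.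
    by move=> s; rewrite (sum_perm (fun r => grad (f r) (x_ s y i))).
  rewrite !vavg_sum; apply: eq_bigr => l _.
  rewrite -(vavg_reindex (tperm l i)); apply: eq_vavg => s.
  by rewrite permM tpermL.
rewrite E.
have -> : vavg (fun s : 'S_n => grad (f (s i)) (x_ s y i)) =
   N^-1 *: \sum_(l < n) vavg (fun s : 'S_n => grad (f (s i)) (x_ s y i)).
  by rewrite sumr_const card_ord -[vavg _ *+ _]scaler_nat scalerA mulVf ?scale1r ?gt_eqF.
rewrite -scalerBr -sumrB enormZ ger0_norm ?invr_ge0 // ler_pdivrMl //.
apply: le_trans (enorm_sum _ _ _) _.
have -> : N * (4 * e * L * G) = \sum_(l < n) 4 * e * L * G.
  by rewrite sumr_const card_ord mulr_natl.
apply: ler_sum => l _; rewrite -vavgN -vavgD.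
apply: le_trans (enorm_vavg _) _; rewrite -[leRHS](@savg_cst R n).
apply: ler_savg => s; apply: le_trans (lip _ _ _) _.
have -> : 4 * e * L * G = L * (2 * e * G * 2) by ring.
rewrite ler_wpM2l //.
have := @epoch_stable s (tperm l i * s)%g l i (ltnW (ltn_ord i)).
move=> /(_ _)/le_trans; apply.
  move=> j ji jl; rewrite permM tpermD // 1?eq_sym //.
  by apply/eqP => ij; move: ji; rewrite ij ltnn.
have k : 0 <= 2 * e * G by rewrite !mulr_ge0.
case: ifP => _; last by rewrite mulr_ge0.
by rewrite ler_wpM2l // pow_le2 // ltnW.
Qed.

Let drift i : (i <= n)%N ->
  savg (fun s => enorm (x_ s y i - y) ^+ 2) <=
  8 * (e ^+ 2 * N * G ^+ 2 + t ^+ 2 * enorm (y - xs) ^+ 2).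
Proof.
move=> iln; have := @epoch_drift eta y e 0%N e_ge0 _ i.
rewrite iln => /(_ _ isT)/le_trans; apply.
  by move=> j _; rewrite etaE e_ge0 lexx.
have -> : savg (fun s => enorm (x_ s y 0 - xs) ^+ 2) = enorm (y - xs) ^+ 2.
  exact: (savg_cst (enorm (y - xs) ^+ 2)).
have -> : 8 * (e ^+ 2 * N * G ^+ 2 + t ^+ 2 * enorm (y - xs) ^+ 2) =
   (4 * e ^+ 2 * N * G ^+ 2 + 4 * t ^+ 2 * enorm (y - xs) ^+ 2) * 2 by ring.
rewrite ler_wpM2l //; first by rewrite addr_ge0 // !mulr_ge0 ?enorm_ge0.
apply: expR_le2; have := ler_pM t_ge0 t_ge0 t_small t_small.
by rewrite -expr2; lra.
Qed.

(** * Second-order expansion of the mean gradient along an epoch *)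

Section SecondOrder.
Variables (A : 'M[R]_d) (rho nu : R).
Hypothesis nu01 : 0 <= nu <= 1.
Hypothesis rho_ge0 : 0 <= rho.
Hypothesis taylor : forall x,
  enorm (gavg x - gavg y - (x - y) *m A) <= rho * enorm (x - y) `^ (1 + nu).

Local Notation ey := (enorm (y - xs)).

(** The typical displacement inside an epoch: noise plus drift. [G + 1] in place of [G] makes it
    positive, as the scale in [powR_interp] must be. *)
Definition spread : R := e * Num.sqrt N * (G + 1) + t * ey.

Let spread_gt0 : 0 < spread.
Proof.
rewrite /spread ltr_pwDl ?mulr_ge0 ?enorm_ge0 //.
by rewrite !mulr_gt0 ?sqrtr_gt0 // ltr_wpDl.
Qed.

Let moment2 i : (i <= n)%N ->
  savg (fun s => enorm (x_ s y i - y) ^+ 2) <= 8 * spread ^+ 2.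
Proof.
move=> iln; apply: le_trans (drift iln) _; rewrite ler_wpM2l //.
have sN : Num.sqrt N ^+ 2 = N by rewrite sqr_sqrtr.
have -> : spread ^+ 2 = e ^+ 2 * Num.sqrt N ^+ 2 * (G + 1) ^+ 2 +
   2 * (e * Num.sqrt N * (G + 1) * (t * ey)) + t ^+ 2 * ey ^+ 2.
  by rewrite /spread; ring.
rewrite sN.
have k1 : 0 <= e * Num.sqrt N * (G + 1) * (t * ey).
  by rewrite !mulr_ge0 ?sqrtr_ge0 ?enorm_ge0 // addr_ge0.
have k2 : e ^+ 2 * N * G ^+ 2 <= e ^+ 2 * N * (G + 1) ^+ 2.
  rewrite ler_wpM2l ?mulr_ge0 // lerXn2r ?nnegrE ?addr_ge0 // lerDl //.
lra.
Qed.

Let savg_powR i : (i <= n)%N ->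
  savg (fun s => enorm (x_ s y i - y) `^ (1 + nu)) <= 9 * spread `^ (1 + nu).
Proof.
move=> iln.
apply: (@le_trans _ _ (savg (fun s => spread `^ (1 + nu) +
    spread `^ (1 + nu) / spread ^+ 2 * enorm (x_ s y i - y) ^+ 2))).
  apply: ler_savg => s.
  apply: le_trans (powR_interp (enorm_ge0 _) spread_gt0 nu01) _.
  by rewrite mulrDr mulr1 [_ / spread ^+ 2 * _]mulrAC -mulrA.
rewrite savgD savg_cst savgZ.
have -> : 9 * spread `^ (1 + nu) = spread `^ (1 + nu) +
   spread `^ (1 + nu) / spread ^+ 2 * (8 * spread ^+ 2).
  by field; rewrite gt_eqF.
rewrite lerD2l ler_wpM2l ?moment2 //.
by rewrite divr_ge0 ?powR_ge0 ?sqr_ge0.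
Qed.

Let mean_powR i : (i <= n)%N ->
  enorm (vavg (fun s : 'S_n => x_ s y i - y)) `^ (1 + nu) <=
    9 * spread `^ (1 + nu).
Proof.
move=> iln.
apply: le_trans (powR_interp (enorm_ge0 _) spread_gt0 nu01) _.
rewrite [leRHS]mulrC ler_wpM2l ?powR_ge0 //.
suff : enorm (vavg (fun s : 'S_n => x_ s y i - y)) ^+ 2 / spread ^+ 2 <= 8 by lra.
rewrite ler_pdivrMr ?exprn_gt0 //; apply: le_trans (moment2 iln).
apply: le_trans (savg_sqr_le _).
rewrite lerXn2r ?nnegrE ?enorm_ge0 ?enorm_vavg //.
by apply: savg_ge0 => s; exact: enorm_ge0.
Qed.

(** Bias of the full gradient along the epoch. [b_le] bounds it by the mean displacement, [z_le]
    bounds the mean displacement by the earlier biases, and [b_bound] closes this system by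
    Gronwall. *)
Let b i := enorm (vavg (fun s : 'S_n => gavg (x_ s y i)) - gavg y).

(** Taylor's formula is used twice, at the iterates and at their mean [y + z]. Both linear parts
    average to [z *m A] and cancel, so no bound on [A] enters, only the Lipschitz constant of
    [gavg]. *)
Let b_le i : (i <= n)%N ->
  b i <= L * enorm (vavg (fun s : 'S_n => x_ s y i - y)) +
         18 * rho * spread `^ (1 + nu).
Proof.
move=> iln; set z := vavg _.
have -> : b i = enorm (vavg (fun s : 'S_n =>
      gavg (x_ s y i) - gavg y - (x_ s y i - y) *m A) +
    ((gavg (y + z) - gavg y) - (gavg (y + z) - gavg y - z *m A))).
  rewrite /b !vavgD !vavgN vavg_cst vavg_mulmx -/z.
  congr enorm; rewrite [X in _ = _ + X](_ : _ = z *m A) ?subrK //.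
  by rewrite opprB addrCA subrr addr0.
apply: le_trans (enormD _ _) _.
have h1 : enorm (vavg (fun s : 'S_n =>
      gavg (x_ s y i) - gavg y - (x_ s y i - y) *m A)) <=
    9 * rho * spread `^ (1 + nu).
  apply: le_trans (enorm_vavg _) _.
  apply: (@le_trans _ _ (savg (fun s =>
      rho * enorm (x_ s y i - y) `^ (1 + nu)))).
    by apply: ler_savg => s; exact: taylor.
  by rewrite savgZ -mulrA mulrCA ler_wpM2l // savg_powR.
have h2 : enorm (gavg (y + z) - gavg y) <= L * enorm z.
  by apply: le_trans (gavg_lipschitz _ _) _; rewrite addrAC subrr add0r.
have h3 : enorm (gavg (y + z) - gavg y - z *m A) <= 9 * rho * spread `^ (1 + nu).
  have := taylor (y + z); rewrite (_ : y + z - y = z); last first.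
    by rewrite addrAC subrr add0r.
  move=> /le_trans; apply.
  by rewrite -mulrA mulrCA ler_wpM2l // mean_powR.
apply: le_trans (lerD h1 (le_trans (enormB _ _) (lerD h2 h3))) _.
lra.
Qed.

Let gavg_y : enorm (gavg y) <= L * ey.
Proof. by have := gavg_lipschitz y xs; rewrite gavg_xs subr0. Qed.

Let step_mean_le (i : 'I_n) :
  enorm (vavg (fun s : 'S_n => grad (f (s i)) (x_ s y i)) - gavg y) <=
  4 * e * L * G + b i.
Proof.
rewrite -[X in enorm X](subrKA (vavg (fun s : 'S_n => gavg (x_ s y i)))).
exact: le_trans (enormD _ _) (lerD (epoch_bias i) (lexx _)).
Qed.

Let z_le i : (i <= n)%N ->
  enorm (vavg (fun s : 'S_n => x_ s y i - y)) <=
  e * (N * (4 * e * L * G + L * ey)) + e * \sum_(j < n | (0 <= j < i)%N) b j.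
Proof.
move=> iln.
have -> : vavg (fun s : 'S_n => x_ s y i - y) =
   - (e *: \sum_(j < n | (0 <= j < i)%N)
       vavg (fun s : 'S_n => grad (f (s j)) (x_ s y j))).
  rewrite -vavg_sum -vavgZ -vavgN; apply: eq_vavg => s.
  rewrite (@rr_epoch_sum eta s y 0 i) ?iln //; congr (- _).
  by rewrite scaler_sumr; apply: eq_bigr => j _; rewrite etaE.
rewrite enormN enormZ ger0_norm // -mulrDr ler_wpM2l //.
apply: le_trans (enorm_sum _ _ _) _.
have c0 : 0 <= 4 * e * L * G + L * ey.
  by rewrite addr_ge0 ?mulr_ge0 ?enorm_ge0.
apply: (@le_trans _ _ (\sum_(j < n | (0 <= j < i)%N)
    ((4 * e * L * G + L * ey) + b j))).
  apply: ler_sum => j _.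
  rewrite -[X in enorm X](subrK (gavg y)); apply: le_trans (enormD _ _) _.
  by have := step_mean_le j; move: gavg_y; lra.
rewrite big_split /= lerD2r.
have -> : N * (4 * e * L * G + L * ey) =
    \sum_(j < n) (4 * e * L * G + L * ey).
  by rewrite sumr_const card_ord mulr_natl.
rewrite [leRHS](bigID (fun j : 'I_n => (0 <= j < i)%N)) /= lerDl.
by apply: sumr_ge0.
Qed.

Let b_bound i : (i <= n)%N ->
  b i <= 2 * (t * (4 * e * L * G + L * ey) + 18 * rho * spread `^ (1 + nu)).
Proof.
move=> iln; set B := t * _ + _.
have B0 : 0 <= B.
  by rewrite /B addr_ge0 // ?mulr_ge0 ?addr_ge0 ?mulr_ge0 ?enorm_ge0 ?powR_ge0.
have eL : 0 <= e * L by rewrite mulr_ge0.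
have := @discrete_gronwall _ b B (e * L) 0%N n B0 eL.
move=> /(_ _ i iln)/le_trans; apply.
  move=> j /andP[_ jn]; apply: le_trans (b_le jn) _.
  by have := ler_wpM2l L_ge0 (z_le jn); rewrite /B; lra.
by rewrite mulrC ler_wpM2r // expR_le2 //; move: t_small; lra.
Qed.

(** An epoch is a full gradient step of length e n from [y], minus [e] times this error. *)
Let drift_sum (s : 'S_n) : 'rV[R]_d :=
  \sum_(i < n) (grad (f (s i)) (x_ s y i) - grad (f (s i)) y).

Let mean_drift_sum :
  enorm (vavg (fun s : 'S_n => drift_sum s)) <=
  N * (6 * e * L * G + 2 * t * L * ey + 36 * rho * spread `^ (1 + nu)).
Proof.
have -> : vavg (fun s : 'S_n => drift_sum s) = \sum_(i < n)
    (vavg (fun s : 'S_n => grad (f (s i)) (x_ s y i)) - gavg y).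
  rewrite sumrB sumr_const card_ord -vavg_sum.
  rewrite -(@vavg_cst R n d (gavg y *+ n)) -vavgN -vavgD.
  apply: eq_vavg => s; rewrite /drift_sum sumrB; congr (_ - _).
  rewrite (sum_perm (fun r => grad (f r) y)) /gavg -scaler_nat scalerA.
  by rewrite mulfV ?scale1r // gt_eqF.
apply: le_trans (enorm_sum _ _ _) _.
set B := _ + 36 * rho * _.
have -> : N * B = \sum_(i < n) B by rewrite sumr_const card_ord mulr_natl.
apply: ler_sum => i _; apply: le_trans (step_mean_le i) _.
have eLG : 0 <= e * L * G by rewrite !mulr_ge0.
(* As t <= 1/4, the contributions 4 and 8 t of e L G add up to at most 6; 36 is 2 times 18. *)
have k : t * (e * L * G) <= 1 / 4 * (e * L * G) by rewrite ler_wpM2r.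
have := b_bound (ltnW (ltn_ord i)); rewrite /B; lra.
Qed.

Let moment2_drift_sum :
  savg (fun s : 'S_n => enorm (drift_sum s) ^+ 2) <=
  8 * L ^+ 2 * N ^+ 2 * (e ^+ 2 * N * G ^+ 2 + t ^+ 2 * ey ^+ 2).
Proof.
apply: (@le_trans _ _ (savg (fun s : 'S_n =>
    N * L ^+ 2 * \sum_(i < n) enorm (x_ s y i - y) ^+ 2))).
  apply: ler_savg => s; apply: le_trans (enorm_sum_sqr _ _) _.
  rewrite -mulrA ler_wpM2l // mulr_sumr; apply: ler_sum => i _.
  by rewrite -exprMn lerXn2r ?nnegrE ?mulr_ge0 ?enorm_ge0 // lip.
rewrite savgZ savg_sum.
set D := _ + t ^+ 2 * _.
have -> : 8 * L ^+ 2 * N ^+ 2 * D = N * L ^+ 2 * (N * (8 * D)) by ring.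
rewrite ler_wpM2l ?mulr_ge0 //.
have -> : N * (8 * D) = \sum_(i < n) 8 * D by rewrite sumr_const card_ord mulr_natl.
by apply: ler_sum => i _; exact: (drift (ltnW (ltn_ord i))).
Qed.

(** The square of [w - e *: drift_sum s] is expanded. The cross term needs only the mean of the
    error, whose noise part is smaller by a factor sqrt(n) than its root mean square; the second
    moment is multiplied by [e ^+ 2]. *)
Lemma constant_step_epoch :
  savg (fun s => enorm (x_ s y n - xs) ^+ 2) <=
  (1 - 2 * (e * N) * mu + t ^+ 2) * ey ^+ 2 +
  4 * (e * N) * ey *
    (6 * e * L * G + 2 * t * L * ey + 36 * rho * spread `^ (1 + nu)) +
  8 * t ^+ 2 * (e ^+ 2 * N * G ^+ 2 + t ^+ 2 * ey ^+ 2).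
Proof.
pose w := (y - xs) - (e * N) *: gavg y.
have xE s : x_ s y n - xs = w - e *: drift_sum s.
  have -> : x_ s y n - xs = (y - xs) + (x_ s y n - y).
    by rewrite [RHS]addrC addrA subrK.
  have h : x_ s y n - y = - \sum_(j < n | (0 <= j < n)%N)
      eta j.+1 *: grad (f (s j)) (x_ s y j).
    exact: (@rr_epoch_sum eta s y 0 n (leqnn n)).
  rewrite h /w -[RHS]addrA -opprD; congr (_ - _).
  rewrite /drift_sum sumrB scalerBr (sum_perm (fun r => grad (f r) y)).
  rewrite /gavg scalerA mulfK ?gt_eqF // addrCA subrr addr0 scaler_sumr.
  by apply: eq_big => [j|j _]; rewrite ?ltn_ord // etaE.
have -> : savg (fun s => enorm (x_ s y n - xs) ^+ 2) =
   enorm w ^+ 2 + - (2 * e) * edot w (vavg (fun s : 'S_n => drift_sum s)) +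
   e ^+ 2 * savg (fun s : 'S_n => enorm (drift_sum s) ^+ 2).
  rewrite -savg_edot -!savgZ -[enorm w ^+ 2](@savg_cst R n) -!savgD.
  apply: eq_savg => s; rewrite xE !enorm_sqr.
  move: (w) (drift_sum s) => v u.
  by rewrite !edotE (edotC u v); ring.
set B := _ + 36 * rho * _; set D := _ + t ^+ 2 * _.
have ey0 : 0 <= ey by exact: enorm_ge0.
have gy := gavg_y; have gy0 := enorm_ge0 (gavg y).
have eN : 0 <= e * N by rewrite mulr_ge0.
have w1 : enorm w <= 2 * ey.
  apply: le_trans (enormB _ _) _; rewrite enormZ ger0_norm //.
  have := ler_wpM2l eN gy; have := ler_wpM2r ey0 t_small; lra.
have w2 : enorm w ^+ 2 <= (1 - 2 * (e * N) * mu + t ^+ 2) * ey ^+ 2.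
  have -> : enorm w ^+ 2 = ey ^+ 2 - 2 * (e * N) * edot (y - xs) (gavg y) +
      (e * N) ^+ 2 * enorm (gavg y) ^+ 2.
    rewrite !enorm_sqr /w; move: (y - xs) (gavg y) => v u.
    by rewrite !edotE (edotC u v); ring.
  have m1 : mu * ey ^+ 2 <= edot (y - xs) (gavg y).
    rewrite /gavg edotZr ler_pdivlMl //.
    by have := monotone y; lra.
  have m2 : enorm (gavg y) ^+ 2 <= (L * ey) ^+ 2.
    by rewrite lerXn2r ?nnegrE ?mulr_ge0.
  have := ler_wpM2l eN m1; have := ler_wpM2l (sqr_ge0 (e * N)) m2; lra.
have w3 : - (2 * e) * edot w (vavg (fun s : 'S_n => drift_sum s)) <=
    4 * (e * N) * ey * B.
  rewrite mulNr -mulrN -edotNr.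
  have -> : 4 * (e * N) * ey * B = 2 * e * (2 * ey * (N * B)) by ring.
  rewrite ler_wpM2l ?mulr_ge0 //.
  apply: le_trans (edot_le _ _) _; rewrite enormN.
  by rewrite ler_pM ?enorm_ge0.
have w4 := ler_wpM2l (sqr_ge0 e) moment2_drift_sum.
have -> : 8 * t ^+ 2 * D = e ^+ 2 * (8 * L ^+ 2 * N ^+ 2 * D) by ring.
by rewrite !lerD.
Qed.

End SecondOrder.

End ConstantStep.

End Epoch.

(** * The recursion over the epochs *)

Section Scalar.
Context {R : realType}.

Lemma powR_le1D (x nu : R) : 0 <= x -> 0 <= nu <= 1 -> x `^ nu <= 1 + x.
Proof.
move=> x0 /andP[nu0 nu1]; have [x1|x1] := leP x 1.
  have : x `^ nu <= 1 `^ nu by rewrite ge0_ler_powR // nnegrE.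
  by rewrite powR1; lra.
have : x `^ nu <= x `^ 1 by rewrite ler_powR // ltW.
by rewrite powRr1 //; lra.
Qed.

Lemma powR_add_le (a b nu : R) : 0 <= a -> 0 <= b -> 0 <= nu <= 1 ->
  (a + b) `^ (1 + nu) <= 4 * (a `^ (1 + nu) + b `^ (1 + nu)).
Proof.
move=> a0 b0 /andP[nu0 nu1].
have p0 : 0 <= 1 + nu by rewrite addr_ge0.
have two : 2 `^ (1 + nu) <= 4 :> R.
  have : 2 `^ (1 + nu) <= 2 `^ 2 :> R by rewrite ler_powR ?ler1n //; lra.
  by rewrite (powR_mulrn 2) ?ler0n //; lra.
suff h u v : 0 <= u -> u <= v -> (u + v) `^ (1 + nu) <= 4 * v `^ (1 + nu).
  have ha := powR_ge0 a (1 + nu); have hb := powR_ge0 b (1 + nu).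
  have [ab|ba] := leP a b; first by have := h _ _ a0 ab; lra.
  by have := h _ _ b0 (ltW ba); rewrite addrC; lra.
move=> u0 uv; have v0 := le_trans u0 uv.
apply: (@le_trans _ _ ((2 * v) `^ (1 + nu))).
  by rewrite ge0_ler_powR ?nnegrE ?addr_ge0 ?mulr_ge0 //; lra.
by rewrite powRM ?ler0n // ler_wpM2r ?powR_ge0.
Qed.

Definition rate (nu N q : R) : R :=
  (q ^+ 2)^-1 + N ^+ 2 / q ^+ 3 + N `^ (1 + nu) / q `^ (2 + 2 * nu).

(* [r] stands for the coefficient [36 * rho] of [constant_step_epoch]. *)
Variables (L mu G r nu c : R).

(** Threshold for e n: the first entry gives e L n <= 1/4, the second keeps all terms in (e n)^2
    times the squared distance below e n mu / 2 times it. *)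
Definition small_step : R :=
  Num.min (1 / (4 * L))
    (mu / (2 * (2 * L ^+ 2 + 4 * L * (2 * L + 4 * r * (1 + G / mu))))).

(** The summands belong, in this order, to the three terms of [rate]. *)
Definition noise_const : R :=
  16 * (6 * L * G) ^+ 2 * c ^+ 3 / mu + 8 * L ^+ 2 * G ^+ 2 * c ^+ 4 +
  16 * (4 * r) ^+ 2 * c * (c ^+ 2 * (G + 1) ^+ 2) `^ (1 + nu) / mu.

Hypothesis L_gt0 : 0 < L.
Hypothesis mu_gt0 : 0 < mu.
Hypothesis G_ge0 : 0 <= G.
Hypothesis r_ge0 : 0 <= r.
Hypothesis nu01 : 0 <= nu <= 1.
Hypothesis c_mu : 8 <= c * mu.

Let c_gt0 : 0 < c.
Proof. by rewrite -(pmulr_lgt0 _ mu_gt0) (lt_le_trans _ c_mu). Qed.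

Let slope_gt0 :
  0 < 2 * (2 * L ^+ 2 + 4 * L * (2 * L + 4 * r * (1 + G / mu))).
Proof.
have D0 : 0 <= G / mu by rewrite divr_ge0 // ltW.
have r0 : 0 <= 4 * r * (1 + G / mu) by rewrite !mulr_ge0 // addr_ge0.
rewrite mulr_gt0 // ltr_wpDr ?mulr_gt0 ?exprn_gt0 //.
have L0 := ltW L_gt0.
have h : 0 <= 2 * L + 4 * r * (1 + G / mu) by rewrite addr_ge0 // mulr_ge0.
by rewrite mulr_ge0 // mulr_ge0.
Qed.

Lemma small_step_gt0 : 0 < small_step.
Proof.
rewrite /small_step lt_min; apply/andP; split; last by rewrite divr_gt0.
by rewrite divr_gt0 ?mulr_gt0.
Qed.

Lemma noise_const_ge0 : 0 <= noise_const.
Proof.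
have [c0 m0 L0] := And3 (ltW c_gt0) (ltW mu_gt0) (ltW L_gt0).
rewrite /noise_const !addr_ge0 //.
- by rewrite divr_ge0 // !mulr_ge0 // exprn_ge0.
- by rewrite !mulr_ge0 // exprn_ge0.
- by rewrite divr_ge0 // !mulr_ge0 // powR_ge0.
Qed.

Lemma contraction_bound (N q ey : R) : 0 < N -> 0 < q -> 0 <= ey <= G / mu ->
  c / q * N <= small_step ->
  (1 - 2 * (c / q * N) * mu + (c / q * L * N) ^+ 2) * ey ^+ 2 +
  4 * (c / q * N) * ey *
    (6 * (c / q) * L * G + 2 * (c / q * L * N) * L * ey +
     r * (c / q * Num.sqrt N * (G + 1) + c / q * L * N * ey) `^ (1 + nu)) +
  8 * (c / q * L * N) ^+ 2 *
    ((c / q) ^+ 2 * N * G ^+ 2 + (c / q * L * N) ^+ 2 * ey ^+ 2) <=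
  (1 - 8 * (N / q)) * ey ^+ 2 + noise_const * (N / q) * rate nu N q.
Proof.
move=> N0 q0 /andP[ey0 eyD] hs; have /andP[nu0 nu1] := nu01.
have [c0 m0 L0] := And3 (ltW c_gt0) (ltW mu_gt0) (ltW L_gt0).
have [Ng0 qg0] := (ltW N0, ltW q0).
set e := c / q in hs *; have e0 : 0 < e by rewrite divr_gt0.
have eE : e = c / q by []; clearbody e.
have eg0 := ltW e0.
have {hs} : e * N <= 1 / (4 * L) /\
  e * N <= mu / (2 * (2 * L ^+ 2 + 4 * L * (2 * L + 4 * r * (1 + G / mu)))).
  by apply/andP; rewrite -le_min.
set th := e * N; move=> [hs1 hs2].
have th0 : 0 < th by rewrite mulr_gt0.
have thg0 := ltW th0; have thE : th = e * N by []; clearbody th.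
set D := G / mu in eyD hs2 *.
have D0 : 0 <= D by rewrite divr_ge0.
have DE : D = G / mu by []; clearbody D.
have tE : e * L * N = th * L by rewrite thE mulrAC.
rewrite tE; set t := th * L.
have t0 : 0 < t by rewrite mulr_gt0.
have tg0 := ltW t0; have tthE : t = th * L by []; clearbody t.
have t4 : t <= 1 / 4.
  have -> : 1 / 4 = 1 / (4 * L) * L :> R by field; rewrite gt_eqF.
  by rewrite tthE ler_wpM2r.
set S0 := e * Num.sqrt N * (G + 1).
have S00 : 0 <= S0 by rewrite !mulr_ge0 ?sqrtr_ge0 ?addr_ge0 //.
have S0E : S0 = e * Num.sqrt N * (G + 1) by []; clearbody S0.
have te0 : 0 <= t * ey by rewrite mulr_ge0 //.
set s0p := S0 `^ (1 + nu).
have s0p0 : 0 <= s0p by exact: powR_ge0.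
have s0pE : s0p = S0 `^ (1 + nu) by []; clearbody s0p.
(* The distance part of the fractional power is linearized by the a priori bound [D]; its factor [t]
   then makes it one of the quadratic terms. *)
have hS : (S0 + t * ey) `^ (1 + nu) <= 4 * (s0p + (1 + D) * (t * ey)).
  apply: le_trans (powR_add_le S00 te0 nu01) _; rewrite -s0pE ler_wpM2l // lerD2l.
  rewrite powRD; last by rewrite gt_eqF // ltr_pwDl.
  rewrite powRr1 // mulrC ler_wpM2r //.
  apply: le_trans (powR_le1D te0 nu01) _; rewrite lerD2l.
  have : t * ey <= 1 / 4 * ey by rewrite ler_wpM2r.
  lra.
pose X := 6 * e * L * G + 4 * r * s0p.
pose A1 := 2 * L + 4 * r * (1 + D).
have A10 : 0 <= A1.
  by rewrite addr_ge0 ?mulr_ge0 ?addr_ge0 //.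
have hB : 6 * e * L * G + 2 * t * L * ey +
     r * (S0 + t * ey) `^ (1 + nu) <= X + A1 * (t * ey).
  have := ler_wpM2l r_ge0 hS; rewrite /X /A1; lra.
have k0 : 0 <= 4 * th * ey by rewrite !mulr_ge0 //.
have hB1 := ler_wpM2l k0 hB.
have Xsq : 4 * th * ey * X <= th * (mu / 2) * ey ^+ 2 + th * (8 / mu) * X ^+ 2.
  have h := sqr_ge0 (mu * ey - 4 * X).
  have m20 : 0 <= th / (2 * mu) by rewrite divr_ge0 ?mulr_ge0 //.
  have := mulr_ge0 m20 h.
  have -> : th / (2 * mu) * (mu * ey - 4 * X) ^+ 2 =
     th * (mu / 2) * ey ^+ 2 - 4 * th * ey * X + th * (8 / mu) * X ^+ 2.
    by field; rewrite gt_eqF.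
  lra.
have X2 : X ^+ 2 <= 2 * (6 * e * L * G) ^+ 2 + 2 * (4 * r) ^+ 2 * s0p ^+ 2.
  have := sqr_ge0 (6 * e * L * G - 4 * r * s0p).
  by rewrite /X; lra.
have X3 : th * (8 / mu) * X ^+ 2 <=
   th * (8 / mu) * (2 * (6 * e * L * G) ^+ 2 + 2 * (4 * r) ^+ 2 * s0p ^+ 2).
  by rewrite ler_wpM2l // !mulr_ge0 ?invr_ge0 //.
have t2 : t ^+ 2 <= 1 / 16.
  by have := ler_pM (ltW t0) (ltW t0) t4 t4; rewrite -expr2; lra.
have t2e : 0 <= t ^+ 2 * ey ^+ 2 by rewrite mulr_ge0 ?sqr_ge0.
have t44 : t ^+ 2 * (t ^+ 2 * ey ^+ 2) <= 1 / 16 * (t ^+ 2 * ey ^+ 2).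
  by rewrite ler_wpM2r.
have sl : th * (2 * L ^+ 2 + 4 * L * A1) <= mu / 2.
  have := slope_gt0; rewrite -DE => sg0.
  have := hs2; rewrite ler_pdivlMr // /A1; lra.
have sl2 : th ^+ 2 * (2 * L ^+ 2 + 4 * L * A1) * ey ^+ 2 <= th * (mu / 2) * ey ^+ 2.
  by rewrite ler_wpM2r ?sqr_ge0 // expr2 -mulrA ler_wpM2l //.
have thm : 8 * (N / q) <= th * mu.
  have -> : th * mu = c * mu * (N / q) by rewrite thE eE; ring.
  by rewrite ler_wpM2r // divr_ge0 //.
have thm2 : 8 * (N / q) * ey ^+ 2 <= th * mu * ey ^+ 2 by rewrite ler_wpM2r ?sqr_ge0.
have tt : t ^+ 2 * ey ^+ 2 = th ^+ 2 * L ^+ 2 * ey ^+ 2 by rewrite tthE; ring.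
have ttA : 4 * th * ey * (A1 * (t * ey)) = th ^+ 2 * (4 * L * A1) * ey ^+ 2.
  by rewrite tthE; ring.
have noise : th * (8 / mu) * (2 * (6 * e * L * G) ^+ 2 + 2 * (4 * r) ^+ 2 * s0p ^+ 2)
    + 8 * t ^+ 2 * (e ^+ 2 * N * G ^+ 2) <= noise_const * (N / q) * rate nu N q.
  (* [S0 ^+ 2] is a constant times N / q^2; its power 1 + nu is the third term of [rate]. *)
  have sE : s0p ^+ 2 = (c ^+ 2 * (G + 1) ^+ 2) `^ (1 + nu) *
      (N `^ (1 + nu) / q `^ (2 + 2 * nu)).
    have -> : s0p ^+ 2 = (S0 ^+ 2) `^ (1 + nu).
      by rewrite s0pE -(powR_mulrn 2 (powR_ge0 _ _)) -(powR_mulrn 2 S00) -!powRrM mulrC.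
    have -> : S0 ^+ 2 = c ^+ 2 * (G + 1) ^+ 2 * (N / q ^+ 2).
      rewrite S0E !exprMn sqr_sqrtr ?(ltW N0) // eE.
      by field; rewrite gt_eqF.
    have q2 : 0 <= (q ^+ 2)^-1 by rewrite invr_ge0 exprn_ge0 //.
    rewrite powRM; last 2 first.
    - by rewrite mulr_ge0 ?sqr_ge0.
    - by rewrite divr_ge0 ?sqr_ge0 //.
    congr (_ * _); rewrite powRM ?(ltW N0) //; congr (_ * _).
    rewrite -powR_inv1 ?sqr_ge0 // -powRrM mulN1r powRN; congr (_^-1).
    rewrite -(powR_mulrn 2) ?(ltW q0) // -powRrM; congr (_ `^ _); ring.
  pose u := N / q; have u0 : 0 <= u by rewrite divr_ge0.
  pose r1 := (q ^+ 2)^-1; pose r2 := N ^+ 2 / q ^+ 3.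
  pose r3 := N `^ (1 + nu) / q `^ (2 + 2 * nu).
  have r10 : 0 <= r1 by rewrite invr_ge0 sqr_ge0.
  have r20 : 0 <= r2 by rewrite divr_ge0 ?exprn_ge0 //.
  have r30 : 0 <= r3 by rewrite divr_ge0 ?powR_ge0.
  pose B1 := 16 * (6 * L * G) ^+ 2 * c ^+ 3 / mu.
  pose B2 := 8 * L ^+ 2 * G ^+ 2 * c ^+ 4.
  pose B3 := 16 * (4 * r) ^+ 2 * c * (c ^+ 2 * (G + 1) ^+ 2) `^ (1 + nu) / mu.
  have B10 : 0 <= B1 by rewrite divr_ge0 ?mulr_ge0 ?exprn_ge0 //.
  have B20 : 0 <= B2 by rewrite !mulr_ge0 ?exprn_ge0 //.
  have B30 : 0 <= B3 by rewrite divr_ge0 ?mulr_ge0 ?exprn_ge0 ?powR_ge0 //.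
  have -> : th * (8 / mu) * (2 * (6 * e * L * G) ^+ 2 + 2 * (4 * r) ^+ 2 * s0p ^+ 2)
    + 8 * t ^+ 2 * (e ^+ 2 * N * G ^+ 2) = u * (B1 * r1 + B2 * r2 + B3 * r3).
    rewrite sE -/r3 /B1 /B2 /B3 /u /r1 /r2 tthE thE eE.
    move: (r3) (_ `^ _) => x3 x4; field; by rewrite !gt_eqF.
  have -> : noise_const * (N / q) * rate nu N q =
     u * ((B1 + B2 + B3) * (r1 + r2 + r3)).
    by rewrite /noise_const -/B1 -/B2 -/B3 /rate -/r1 -/r2 -/r3 -/u; ring.
  rewrite ler_wpM2l // !mulrDl !mulrDr.
  have := (mulr_ge0 B10 r20, mulr_ge0 B10 r30, mulr_ge0 B20 r10,
           mulr_ge0 B20 r30, mulr_ge0 B30 r10, mulr_ge0 B30 r20).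
  move=> [[[[[? ?] ?] ?] ?] ?]; lra.
lra.
Qed.

End Scalar.

(** * Comparison of the rate at consecutive epochs *)

Section Rate.
Context {R : realType}.
Variables (nu N : R).
Hypothesis nu01 : 0 <= nu <= 1.
Hypothesis N_gt0 : 0 < N.

Lemma rate_ge0 q : 0 < q -> 0 <= rate nu N q.
Proof.
move=> q0; rewrite /rate !addr_ge0 ?divr_ge0 ?powR_ge0 ?invr_ge0 ?exprn_ge0 //.
- exact: ltW.
- exact: ltW.
- exact: ltW.
Qed.

Lemma rate_ge q : 0 < q -> N ^+ 2 / q ^+ 3 <= rate nu N q.
Proof.
move=> q0; rewrite /rate.
have h1 : 0 <= (q ^+ 2)^-1 by rewrite invr_ge0 sqr_ge0.
have h2 : 0 <= N `^ (1 + nu) / q `^ (2 + 2 * nu) by rewrite divr_ge0 ?powR_ge0.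
lra.
Qed.

(** With r = q / (q + N), the three terms shrink by r^2, r^3 and r^(2+2nu), none of them below r^4
    because r <= 1 and nu <= 1. *)
Lemma rate_shift q : 0 < q ->
  (1 - N / (q + N)) ^+ 4 * rate nu N q <= rate nu N (q + N).
Proof.
move=> q0; have /andP[nu0 nu1] := nu01.
set q' := q + N; have q'0 : 0 < q' by rewrite addr_gt0.
pose r := q / q'.
have -> : 1 - N / q' = r by rewrite /r /q'; field; rewrite gt_eqF.
have r0 : 0 < r by rewrite divr_gt0.
have r1 : r <= 1 by rewrite ler_pdivrMr // mul1r lerDl ltW.
have qE : q = r * q' by rewrite /r divfK // gt_eqF.
clearbody r q'; rewrite qE /rate !mulrDr !lerD //.
- have -> : r ^+ 4 * ((r * q') ^+ 2)^-1 = r ^+ 2 * (q' ^+ 2)^-1.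
    by field; rewrite !gt_eqF.
  by rewrite ler_piMl ?invr_ge0 ?sqr_ge0 // exprn_ile1 // ltW.
- have -> : r ^+ 4 * (N ^+ 2 / (r * q') ^+ 3) = r * (N ^+ 2 / q' ^+ 3).
    by field; rewrite !gt_eqF.
  by rewrite ler_piMl ?divr_ge0 ?sqr_ge0 ?exprn_ge0 // ltW.
rewrite powRM ?(ltW r0) ?(ltW q'0) //.
have rp : r ^+ 4 <= r `^ (2 + 2 * nu).
  rewrite -powR_mulrn ?(ltW r0) // ger_powR ?r0 //; lra.
have rp0 : 0 < r `^ (2 + 2 * nu) by rewrite powR_gt0.
have qp0 : 0 < q' `^ (2 + 2 * nu) by rewrite powR_gt0.
have -> : r ^+ 4 * (N `^ (1 + nu) / (r `^ (2 + 2 * nu) * q' `^ (2 + 2 * nu))) =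
   r ^+ 4 / r `^ (2 + 2 * nu) * (N `^ (1 + nu) / q' `^ (2 + 2 * nu)).
  by field; rewrite !gt_eqF.
by rewrite ler_piMl ?divr_ge0 ?powR_ge0 // ler_pdivrMr // mul1r.
Qed.

(** 1 - 8 u is at most (1 - u)^5: four factors pay for the shift of the rate, and the fifth leaves M
    u times the rate, which absorbs the noise B u since B <= M. *)
Lemma rate_contract (B M q : R) : 0 <= B <= M -> 0 < q -> 8 * N <= q + N ->
  (1 - 8 * (N / (q + N))) * (M * rate nu N q) +
  B * (N / (q + N)) * rate nu N (q + N) <= M * rate nu N (q + N).
Proof.
move=> /andP[B0 BM] q0 q8; have q'0 : 0 < q + N by rewrite addr_gt0.
have hs := rate_shift q0; have rq := rate_ge0 q0; have rq' := rate_ge0 q'0.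
set u := N / (q + N) in hs *.
have u0 : 0 <= u by rewrite divr_ge0 // ltW.
have u8 : u <= 1 / 8 by rewrite ler_pdivrMr //; lra.
clearbody u; move: (rate nu N q) (rate nu N (q + N)) hs rq rq' => x x' hs rq rq'.
have M0 := le_trans B0 BM.
have p5 : 1 - 8 * u <= (1 - u) * (1 - u) ^+ 4.
  have a1 : 1 - 2 * u <= (1 - u) ^+ 2 by have := sqr_ge0 u; lra.
  have a0 : 0 <= 1 - 2 * u by lra.
  have a2 := ler_pM a0 a0 a1 a1.
  have : 1 - 4 * u <= (1 - u) ^+ 4.
    have -> : (1 - u) ^+ 4 = (1 - u) ^+ 2 * (1 - u) ^+ 2 by ring.
    by have := sqr_ge0 u; lra.
  have u1 : 0 <= 1 - u by lra.
  by move=> /(ler_wpM2l u1); have := sqr_ge0 u; lra.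
have h1 : (1 - 8 * u) * (M * x) <= (1 - u) * (M * x').
  apply: (@le_trans _ _ ((1 - u) * (1 - u) ^+ 4 * (M * x))).
    by rewrite ler_wpM2r // mulr_ge0.
  rewrite -mulrA ler_wpM2l; [by []|by lra|].
  by rewrite mulrCA ler_wpM2l.
have h2 : B * u * x' <= M * u * x'.
  by rewrite ler_wpM2r // ler_wpM2r.
lra.
Qed.

End Rate.

(* Crude bounds carry the iterates through the first [K0] epochs, after which
   the contraction takes over. *)
Lemma rate_induction (R : realType) (a : nat -> R) (nu N q C Q B M : R) (K0 : nat) :
  0 <= nu <= 1 -> 1 <= N -> 0 < q -> 2 <= C -> 1 <= Q -> (8 <= K0)%N ->
  0 <= B <= M -> (2 * C) ^+ K0 * Q * (q + K0%:R) ^+ 3 <= M ->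
  a 1%N <= Q / N ->
  (forall k, (1 <= k)%N -> a k.+1 <= C * (a k + N^-1)) ->
  (forall k, (K0 <= k)%N ->
    a k.+1 <= (1 - 8 * (N / (q + N * k%:R + N))) * a k +
      B * (N / (q + N * k%:R + N)) * rate nu N (q + N * k%:R + N)) ->
  forall k, (1 <= k)%N -> a k <= M * rate nu N (q + N * k%:R).
Proof.
move=> nu01 N1 q0 C2 Q1 K08 BM hM a1 crude contr.
have N0 : 0 < N by rewrite (lt_le_trans ltr01).
have qk k : 0 < q + N * k%:R by rewrite ltr_wpDr // mulr_ge0 // ltW.
have Y1 : 1 <= 2 * C by lra.
have early k : (1 <= k)%N -> a k <= (2 * C) ^+ k * Q / N.
  elim: k => // -[_ _|k IH _].
    apply: le_trans a1 _; rewrite expr1 ler_wpM2r ?invr_ge0 ?(ltW N0) //.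
    by rewrite ler_peMl // (le_trans ler01).
  apply: le_trans (crude k.+1 isT) _; have {}IH := IH isT.
  set y := (2 * C) ^+ k.+1 * Q in IH.
  have y1 : 1 <= y by rewrite -[1]mulr1 ler_pM // exprn_ege1.
  have -> : (2 * C) ^+ k.+2 * Q / N = C * (y / N + y / N).
    by rewrite /y [in LHS]exprS; ring.
  rewrite ler_wpM2l //; first by lra.
  by rewrite lerD // ler_peMl // invr_ge0 ltW.
(* As N >= 1, [q + N * k] is at most N (q + K0), so the term N^2 / q^3 alone is of order 1 / N, like
   the early bound. *)
have base k : (1 <= k <= K0)%N -> a k <= M * rate nu N (q + N * k%:R).
  move=> /andP[k1 kK]; apply: le_trans (early _ k1) _.
  have QN : 0 <= Q by rewrite (le_trans ler01).
  apply: (@le_trans _ _ ((2 * C) ^+ K0 * Q / N)).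
    rewrite ler_wpM2r ?invr_ge0 ?(ltW N0) // ler_wpM2r //.
    by rewrite ler_weXn2l.
  have M0 : 0 <= M by have /andP[] := BM; exact: le_trans.
  apply: le_trans (ler_wpM2l M0 (rate_ge nu N (qk k))).
  have kq : q + N * k%:R <= N * (q + K0%:R).
    by rewrite mulrDr lerD ?ler_peMl ?(ltW q0) // ler_wpM2l ?ler_nat // ltW.
  have q3 : (q + N * k%:R) ^+ 3 <= N ^+ 3 * (q + K0%:R) ^+ 3.
    rewrite -exprMn lerXn2r ?nnegrE ?(ltW (qk k)) //.
    by rewrite mulr_ge0 ?(ltW N0) // addr_ge0 // ltW.
  rewrite mulrA ler_pdivlMr ?exprn_gt0 //.
  have c0 : 0 <= (2 * C) ^+ K0 * Q / N.
    by rewrite divr_ge0 ?mulr_ge0 ?exprn_ge0 ?(ltW N0) // (le_trans ler01).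
  apply: le_trans (ler_wpM2l c0 q3) _.
  have -> : (2 * C) ^+ K0 * Q / N * (N ^+ 3 * (q + K0%:R) ^+ 3) =
    (2 * C) ^+ K0 * Q * (q + K0%:R) ^+ 3 * N ^+ 2 by field; rewrite gt_eqF.
  by rewrite ler_wpM2r // sqr_ge0.
move=> k k1; have [kK|] := leqP k K0; first by apply: base; rewrite k1.
elim: k k1 => // k IH _; rewrite ltnS => Kk.
have ak : a k <= M * rate nu N (q + N * k%:R).
  move: Kk; rewrite leq_eqVlt => /predU1P[<-|Kk].
    by apply: base; rewrite leqnn (leq_trans _ K08).
  by apply: IH => //; exact: leq_ltn_trans Kk.
apply: le_trans (contr k Kk) _.
have -> : q + N * k.+1%:R = q + N * k%:R + N by rewrite -natr1; ring.
(* K0 >= 8 keeps the contraction factor nonnegative, so the bound on [a k] can be inserted. *)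
have k8 : 8 <= k%:R :> R by rewrite (ler_nat R 8) (leq_trans K08).
have q8 : 8 * N <= q + N * k%:R + N.
  have := ler_wpM2l (ltW N0) k8; lra.
have u8 : 0 <= 1 - 8 * (N / (q + N * k%:R + N)).
  by rewrite mulrA subr_ge0 ler_pdivrMr ?mul1r // addr_gt0.
apply: le_trans (rate_contract nu01 N0 BM (qk k) q8).
by rewrite lerD2r ler_wpM2l.
Qed.

(** * Expectations over the permutations *)

(** The last permutation is averaged innermost, with the earlier ones fixed: a one-epoch estimate
    applies under the outer averages without conditional expectations. *)
Fixpoint seqavg (R : realType) (n K : nat) (phi : seq 'S_n -> R) : R :=
  if K is K'.+1 then seqavg K' (fun p => savg (fun s => phi (rcons p s)))
  else phi [::].

Section SeqAverage.
Context {R : realType} {n : nat}.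
Implicit Types phi psi : seq 'S_n -> R.

Lemma ler_seqavg K phi psi :
  (forall p, size p = K -> phi p <= psi p) -> seqavg K phi <= seqavg K psi.
Proof.
elim: K phi psi => [|K IH] phi psi h /=; first exact: h.
apply: IH => p pK; apply: ler_savg => s; apply: h.
by rewrite size_rcons pK.
Qed.

Lemma seqavg_affine K (a b : R) phi :
  seqavg K (fun p => a * phi p + b) = a * seqavg K phi + b.
Proof.
elim: K phi => [//|K IH] phi /=; rewrite -IH.
congr (seqavg _ _); apply/funext => p.
by rewrite savgD savgZ savg_cst.
Qed.

Lemma eq_seqavg K phi psi :
  (forall p, size p = K -> phi p = psi p) -> seqavg K phi = seqavg K psi.
Proof.
by move=> h; apply/eqP; rewrite eq_le !ler_seqavg // => p pK; rewrite h.
Qed.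

Lemma seqavg_sum (I : finType) K (F : I -> seq 'S_n -> R) :
  seqavg K (fun p => \sum_i F i p) = \sum_i seqavg K (F i).
Proof.
elim: K F => [//|K IH] F /=.
rewrite -IH; congr (seqavg _ _); apply/funext => p.
by rewrite savg_sum.
Qed.

End SeqAverage.

(** * From the probability space to iterated averages *)

Section Expectation.
Context {disp : measure_display} {T : measurableType disp} {R : realType}.
Context {P : probability T R} {n : nat} {sigma : nat -> T -> 'S_n}.
Hypothesis unif : forall k, uniform_perm P (sigma k).
Hypothesis indep : independent_family P sigma.

Definition cylinder (J : seq nat) (t : nat -> 'S_n) : set T :=
  \bigcap_(k in [set` J]) (sigma k @^-1` [set t k]).

Lemma measurable_cylinder J t : measurable (cylinder J t).
Proof.
rewrite /cylinder bigcap_seq; apply: bigsetI_measurable => k _.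
by have [] := unif k (t k).
Qed.

Lemma cylinder_prob J t : uniq J ->
  P (cylinder J t) = (((n`!%:R : R)^-1) ^+ size J)%:E.
Proof.
move=> uJ; rewrite /cylinder indep //.
under eq_bigr => k _ do rewrite (unif k (t k)).2.
by rewrite prodEFin big_const_seq count_predT iter_mulr_1.
Qed.

(** Every finite choice of permutations has positive probability, hence occurs. This carries the
    confinement of the realized iterates to [X] over to all deterministic paths. *)
Lemma cylinder_nonempty J t : uniq J -> exists w, cylinder J t w.
Proof.
move=> uJ; apply/set0P/eqP => c0; have := cylinder_prob t uJ.
rewrite c0 measure0 => /eqP; rewrite eqe eq_sym expf_eq0 invr_eq0.
by rewrite pnatr_eq0 (gtn_eqF (fact_gt0 n)) andbF.
Qed.

(** Splitting on the value of [sigma K] moves it from the path into the cylinder; repeated, this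
    leaves a constant times an indicator. *)
Lemma path_indicE K m t (phi : seq 'S_n -> R) w :
  phi [seq sigma k w | k <- iota 0 K.+1] * \1_(cylinder (iota K.+1 m) t) w =
  \sum_s phi (rcons [seq sigma k w | k <- iota 0 K] s) *
    \1_(cylinder (iota K m.+1) (fun k => if k == K then s else t k)) w.
Proof.
have -> : [seq sigma k w | k <- iota 0 K.+1] =
    rcons [seq sigma k w | k <- iota 0 K] (sigma K w).
  by rewrite -addn1 iotaD map_cat cats1.
have cE s : cylinder (iota K m.+1) (fun k => if k == K then s else t k) w <->
    (sigma K w = s /\ cylinder (iota K.+1 m) t w).
  rewrite /cylinder /=; split.
    move=> h; split.
      by have := h K; rewrite /= inE eqxx; apply.
    move=> k /= kJ; have := h k; rewrite /= inE kJ orbT gtn_eqF; first exact.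
    by move: kJ; rewrite mem_iota => /andP[].
  move=> [h1 h2] k /=; rewrite inE => /predU1P[->|kJ]; first by rewrite eqxx.
  rewrite gtn_eqF; first exact: h2.
  by move: kJ; rewrite mem_iota => /andP[].
rewrite (bigD1 (sigma K w)) //= big1 => [|s sK]; last first.
  rewrite indicE memNset ?mulr0 // => /cE[sE _].
  by rewrite sE eqxx in sK.
rewrite addr0; congr (_ * _).
rewrite !indicE; congr (nat_of_bool _)%:R; apply/idP/idP; rewrite !inE.
  by move=> h; apply/cE.
by move/cE => [].
Qed.

Lemma measurable_path_indic K m t (phi : seq 'S_n -> R) :
  measurable_fun setT (fun w => phi [seq sigma k w | k <- iota 0 K] *
    \1_(cylinder (iota K m) t) w).
Proof.
elim: K m t phi => [|K IH] m t phi.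
  apply: measurable_funM; first by rewrite /=; exact: measurable_cst.
  by apply: measurable_indic; exact: measurable_cylinder.
under eq_fun do rewrite path_indicE.
apply: measurable_sum => s.
exact: (IH m.+1 _ (fun p => phi (rcons p s))).
Qed.

(** The cylinder is what makes the induction on [K] possible: each step shortens the path and
    lengthens the cylinder, until independence gives the probability. *)
Lemma integral_path_indic K m t (phi : seq 'S_n -> R) : (forall p, 0 <= phi p) ->
  (\int[P]_w (phi [seq sigma k w | k <- iota 0 K] *
     \1_(cylinder (iota K m) t) w)%:E =
  (((n`!%:R : R)^-1) ^+ m * seqavg K phi)%:E)%E.
Proof.
elim: K m t phi => [|K IH] m t phi phi0.
  rewrite /=.
  under eq_integral do rewrite EFinM.
  rewrite ge0_integralZl //; last 2 first.
  - by apply/measurable_EFinP/measurable_indic; exact: measurable_cylinder.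
  - by rewrite lee_fin.
  rewrite integral_indic ?setIT //; last exact: measurable_cylinder.
  have := @cylinder_prob (iota 0 m) t (iota_uniq _ _); rewrite size_iota => h.
  by rewrite mulrC EFinM; congr (_ * _)%E; exact: h.
under eq_integral do rewrite path_indicE -sumEFin.
rewrite ge0_integral_sum //; last 2 first.
- move=> s; apply/measurable_EFinP.
  exact: (@measurable_path_indic K m.+1 _ (fun p => phi (rcons p s))).
- by move=> s w _; rewrite lee_fin mulr_ge0.
under eq_bigr => s _ do
  rewrite (IH m.+1 (fun k => if k == K then s else t k) (fun p => phi (rcons p s))) //.
rewrite sumEFin; congr (_%:E); rewrite -mulr_sumr exprSr -mulrA; congr (_ * _).
rewrite -seqavg_sum -[LHS]addr0 -seqavg_affine; apply: eq_seqavg => p _.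
by rewrite addr0 savg.unlock.
Qed.

Lemma expectation_path K (phi : seq 'S_n -> R) : (forall p, 0 <= phi p) ->
  ('E_P[fun w => phi [seq sigma k w | k <- iota 0 K]] = (seqavg K phi)%:E)%E.
Proof.
move=> phi0; rewrite expectation.unlock -[RHS](_ :
    (((n`!%:R : R)^-1) ^+ 0 * seqavg K phi)%:E = _); last by rewrite expr0 mul1r.
(* With [m = 0] the cylinder is the whole space, and [fun=> 1%g] is a dummy value. *)
rewrite -(@integral_path_indic K 0 (fun=> 1%g)) //.
apply: eq_integral => w _; rewrite /cylinder /= set_nil bigcap_set0.
by rewrite indicT mulr1.
Qed.

End Expectation.

Lemma eq_rr_point (R : realType) (d n : nat) (f : 'I_n -> 'rV[R]_d -> R)
    (eta : nat -> nat -> R) (y0 : 'rV[R]_d) (s s' : nat -> 'S_n) K :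
  (forall k, (k < K)%N -> s k = s' k) ->
  rr_point f eta y0 s K = rr_point f eta y0 s' K.
Proof.
elim: K => //= K IH h; rewrite IH ?h // => k kK.
by apply: h; rewrite ltnS ltnW.
Qed.

Lemma enorm_le_norm (R : realType) (d : nat) (v : 'rV[R]_d) :
  enorm v <= Num.sqrt d%:R * `|v|.
Proof.
rewrite -(@ler_pXn2r _ 2) ?nnegrE ?mulr_ge0 ?enorm_ge0 ?sqrtr_ge0 //.
rewrite exprMn [X in _ <= X * _]sqr_sqrtr // enorm_sqr mulr_natl.
rewrite -[X in _ *+ X](card_ord d) -sumr_const; apply: ler_sum => i _.
rewrite -expr2 -real_normK ?num_real // lerXn2r ?nnegrE //.
rewrite [leRHS]/Num.norm /= mx_normrE.
exact: (le_bigmax _ (fun ij : 'I_1 * 'I_d => `|v ij.1 ij.2|) (0, i)).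
Qed.

(** The [sup] bounds its set only if the set is bounded: compactness bounds [X] in the max norm,
    [enorm_le_norm] transfers this, and the Lipschitz property bounds the gradients. *)
Lemma max_grad_ge (R : realType) (d n : nat) (L : R)
    (f : 'I_n -> 'rV[R]_d -> R) (X : set 'rV[R]_d) r x :
  0 <= L -> (forall i, lipschitz_gradient L (f i)) -> compact X -> X x ->
  enorm (grad (f r) x) <= max_grad f X.
Proof.
move=> L0 lip /compact_bounded[M [_ hM]] Xx.
apply: le_trans (le_bigmax _ _ r).
apply: ub_le_sup; last by exists x.
exists (enorm (grad (f r) x) + L * (Num.sqrt d%:R * (M + 1) + enorm x)).
move=> _ [z Xz <-].
rewrite -[X in enorm X](subrK (grad (f r) x)) addrC.
apply: le_trans (enormD _ _) _; rewrite lerD2l.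
apply: le_trans (lip _ _ _) _; rewrite ler_wpM2l //.
apply: le_trans (enormB _ _) _; rewrite lerD2r.
apply: le_trans (enorm_le_norm _) _; rewrite ler_wpM2l ?sqrtr_ge0 //.
by apply: hM => //; rewrite ltrDl.
Qed.

(** * The run as a function of finite paths of permutations *)

Section Run.
Context {R : realType} {d n : nat} {f : 'I_n -> 'rV[R]_d -> R}.
Context {eta : nat -> nat -> R} {xs y0 : 'rV[R]_d}.

(** The path is padded with the identity; for K <= size p the padding is never read. *)
Definition path_point (p : seq 'S_n) K : 'rV[R]_d :=
  rr_point f eta y0 (nth 1%g p) K.

Definition mean_sqr_dist K : R :=
  seqavg K (fun p => enorm (path_point p K - xs) ^+ 2).

Lemma mean_sqr_distS K : mean_sqr_dist K.+1 = seqavg K (fun p =>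
  savg (fun s => enorm (rr_epoch f (eta K) s (path_point p K) n - xs) ^+ 2)).
Proof.
rewrite /mean_sqr_dist /=; apply: eq_seqavg => p pK; apply: eq_savg => s.
rewrite /path_point /= nth_rcons pK ltnn eqxx.
rewrite (@eq_rr_point _ _ _ _ _ _ _ (nth 1%g p)) // => k kK.
by rewrite nth_rcons pK kK.
Qed.

Lemma mean_sqr_dist_step K (C D : R) :
  (forall p, size p = K ->
    savg (fun s => enorm (rr_epoch f (eta K) s (path_point p K) n - xs) ^+ 2) <=
    C * enorm (path_point p K - xs) ^+ 2 + D) ->
  mean_sqr_dist K.+1 <= C * mean_sqr_dist K + D.
Proof. by move=> h; rewrite mean_sqr_distS -seqavg_affine; exact: ler_seqavg. Qed.

Lemma path_reach (X : set 'rV[R]_d) :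
  (forall (s : nat -> 'S_n) k i, (i <= n)%N -> X (rr_iter f eta y0 s k i)) ->
  forall p K s i, size p = K -> (i <= n)%N ->
    X (rr_epoch f (eta K) s (path_point p K) i).
Proof.
move=> h p K s i pK iln.
have := h (nth 1%g (rcons p s)) K i iln.
rewrite /rr_iter nth_rcons pK ltnn eqxx.
rewrite (@eq_rr_point _ _ _ _ _ _ _ (nth 1%g p)) // => k kK.
by rewrite nth_rcons pK kK.
Qed.

End Run.

(** * Choice of the constants and assembly of the estimates *)

Theorem theorem5p8 (R : realType) (zeta L mu rho nu Gbar : R)
    (hzeta : 4 < zeta) (hmu : 0 < mu) (hmuL : mu <= L)
    (hnu : 0 < nu <= 1) (hrho : 0 <= rho) :
  exists C0 C1 C2 Cnu : R,
    [/\ 0 < C0, 0 < C1, 0 < C2 & 0 < Cnu] /\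
    forall (n d : nat) (f : 'I_n -> 'rV[R]_d -> R) (xs y0 : 'rV[R]_d)
      (X : set 'rV[R]_d)
      (disp : measure_display) (T : measurableType disp)
      (P : probability T R) (sigma : nat -> T -> 'S_n),
    (2 <= n)%N ->
    (forall i, convex_function [set: 'rV[R]_d] (f i)) ->
    (forall i x, differentiable (f i) x) ->
    (forall i, lipschitz_gradient L (f i)) ->
    strongly_convex mu (average f) ->
    unique_minimizer (average f) xs ->
    twice_differentiable (average f) ->
    (forall u v, opnorm (hessian (average f) u - hessian (average f) v)
                   <= rho * enorm (u - v) `^ nu) ->
    (forall k, uniform_perm P (sigma k)) ->
    independent_family P sigma ->
    compact X ->
    X xs ->
    (forall (w : T) (k i : nat), (i <= n)%N ->
       X (rr_iter f (stepsize zeta L mu n) y0 (sigma ^~ w) k i)) ->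
    Gbar = max_grad f X ->
    forall K : nat, (1 <= K)%N ->
      ('E_P[fun w =>
         (enorm (rr_point f (stepsize zeta L mu n) y0 (sigma ^~ w) K - xs)
            ^+ 2)%R]
       <= (C0 * (qpar zeta L mu n 0 / qpar zeta L mu n K) `^ zeta
              * enorm (y0 - xs) ^+ 2
           + C1 / qpar zeta L mu n K ^+ 2
           + C2 * n%:R ^+ 2 / qpar zeta L mu n K ^+ 3
           + Cnu * n%:R `^ (1 + nu)
               / qpar zeta L mu n K `^ (2 + 2 * nu))%R%:E)%E.
Proof.
pose c := 2 * zeta / mu; pose q := zeta * (L / mu); pose r := 36 * rho.
(* Absolute values here and in [M], because the sign of [Gbar] is known only once the problem data
   are introduced. *)
pose Q := 1 + `|first_epoch_const L mu Gbar c q|.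
pose C := crude_const L Gbar c.
pose B := noise_const L mu Gbar r nu c.
(* In epoch k the product e n is at most c / k, so it is below [small_step] from an epoch on that
   does not depend on [n]; 8 is the minimum required by [rate_induction]. *)
pose K0 := (Num.truncn (c / small_step L mu Gbar r)).+1 + 8.
pose M := 1 + `|B| + `|(2 * C) ^+ K0 * Q * (q + K0%:R) ^+ 3|.
have M0 : 0 < M by rewrite /M -addrA ltr_pwDl // addr_ge0.
exists 1, M, M, M; split; first by rewrite ltr01.
move=> n d f xs y0 X disp T P sigma n2 _ df lip sc um td Hh unif indep cX Xxs Xit GE K K1.
have L0 : 0 < L by exact: lt_le_trans hmuL.
have nu01 : 0 <= nu <= 1 by have /andP[/ltW -> ->] := hnu.
have r0 : 0 <= r by rewrite mulr_ge0.
have z0 : 0 < zeta by exact: lt_trans hzeta.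
have c_mu : 8 <= c * mu by rewrite /c divfK ?gt_eqF //; lra.
have c0 : 0 < c by rewrite /c divr_gt0 // mulr_gt0.
have q4 : 4 <= q.
  apply: (@le_trans _ _ zeta); first exact: ltW.
  by rewrite /q ler_peMr ?(ltW z0) // ler_pdivlMr // mul1r.
have q0 : 0 < q by exact: lt_le_trans q4.
have N1 : 1 <= n%:R :> R by rewrite ler1n ltnW.
have N0 : 0 < n%:R :> R by exact: lt_le_trans N1.
have grad_bound i x : X x -> enorm (grad (f i) x) <= Gbar.
  by move=> Xx; rewrite GE; exact: (max_grad_ge i (ltW L0) lip cX Xx).
have G0 : 0 <= Gbar.
  exact: le_trans (enorm_ge0 _) (grad_bound (Ordinal (ltnW n2)) xs Xxs).
have gE x : gavg f x = grad (average f) x by rewrite grad_average.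
have gxs : grad (average f) xs = 0.
  apply: grad_minimizer; first exact: td.1.
  by have : [set x | forall z, average f x <= average f z] xs by rewrite um.
have grad_sum : \sum_i grad (f i) xs = 0.
  move: gxs; rewrite grad_average // => /eqP; rewrite scaler_eq0 invr_eq0.
  by rewrite (gt_eqF N0) => /eqP.
have mono x : n%:R * mu * enorm (x - xs) ^+ 2 <=
    edot (x - xs) (\sum_i grad (f i) x).
  have := strongly_convex_monotone x xs td.1 sc.
  rewrite gxs subr0 grad_average // edotZl edotC -(ler_pM2l N0) !mulrA.
  by rewrite mulfV ?gt_eqF // mul1r.
have taylor y x : enorm (gavg f x - gavg f y - (x - y) *m hessian (average f) y)
    <= rho * enorm (x - y) `^ (1 + nu).
  rewrite !gE; apply: grad_taylor => //.
  by have /andP[] := nu01.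
pose eta := stepsize zeta L mu n.
have reach : forall p k s i, size p = k -> (i <= n)%N ->
    X (rr_epoch f (eta k) s (path_point (f := f) (eta := eta) (y0 := y0) p k) i).
  apply: path_reach => s k i iln.
  (* [x_{k,i}] depends on the permutations 0 to k only, hence the k + 1 prescribed values. *)
  have [w hw] := cylinder_nonempty unif indep s (iota_uniq 0 k.+1).
  have hs j : (j <= k)%N -> sigma j w = s j.
    move=> jk; have : j \in iota 0 k.+1 by rewrite mem_iota add0n ltnS.
    exact: hw.
  have := Xit w k i iln; rewrite /rr_iter hs //.
  rewrite (@eq_rr_point _ _ _ _ _ _ _ s) // => j jk.
  by rewrite hs // ltnW.
pose a k := mean_sqr_dist (f := f) (eta := eta) (y0 := y0) (xs := xs) k.
have qE k : qpar zeta L mu n k = q + n%:R * k%:R by rewrite /qpar natrM.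
have qS k : q + n%:R * k.+1%:R = q + n%:R * k%:R + n%:R.
  by rewrite -natr1; ring.
have etaE k i : (1 <= k)%N -> eta k i.+1 = c / (q + n%:R * k%:R + n%:R).
  case: k => // k _; rewrite /eta /stepsize /= qE -qS /c.
  by rewrite invfM !mulrA.
have qk k : 0 < q + n%:R * k%:R by rewrite ltr_wpDr // mulr_ge0 // ltW.
have qkN k : 0 < q + n%:R * k%:R + n%:R by rewrite addr_gt0.
have dist p k : size p = k ->
    enorm (path_point (f := f) (eta := eta) (y0 := y0) p k - xs) <= Gbar / mu.
  move=> pk; have := reach p k 1%g 0%N pk isT.
  exact: (dist_bound hmu mono n2 Xxs grad_bound).
have small k : (K0 <= k)%N ->
    c / (q + n%:R * k%:R + n%:R) * n%:R <= small_step L mu Gbar r.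
  move=> Kk; have s0 : 0 < small_step L mu Gbar r.
    exact: small_step_gt0.
  have k1 : c / small_step L mu Gbar r <= k%:R.
    apply: (@le_trans _ _ K0%:R); last by rewrite ler_nat.
    apply: (@le_trans _ _ (Num.truncn (c / small_step L mu Gbar r)).+1%:R).
      by apply/ltW/truncnS_gt; rewrite divr_ge0 // ltW.
    by rewrite ler_nat leq_addr.
  rewrite mulrAC ler_pdivrMr //.
  move: k1; rewrite ler_pdivrMr // => k1.
  have := ler_wpM2r (ltW N0) k1; have := mulr_gt0 s0 q0; have := mulr_gt0 s0 N0.
  by lra.
have aK : a K <= M * rate nu n%:R (q + n%:R * K%:R).
  apply: (@rate_induction _ a nu n%:R q C Q B M K0) => //.
  - have : 0 <= (c ^+ 2 * Gbar ^+ 2 + (c * L) ^+ 2) * expR (4 * (c * L) ^+ 2).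
      by rewrite mulr_ge0 ?expR_ge0 // addr_ge0 ?sqr_ge0 // mulr_ge0 ?sqr_ge0.
    by rewrite /C /crude_const; lra.
  - by rewrite /Q lerDl.
  - by rewrite /K0 leq_addl.
  - have B0 : 0 <= B by exact: noise_const_ge0.
    rewrite B0 /= /M (ger0_norm B0) -addrA addrC -addrA lerDl.
    by rewrite addr_ge0.
  - apply: le_trans (ler_norm _) _; rewrite /M lerDr.
    by rewrite addr_ge0.
  - rewrite /a mean_sqr_distS /=.
    apply: (@le_trans _ _ (first_epoch_const L mu Gbar c q / n%:R)).
      apply: (first_epoch hmu hmuL mono n2 L0 lip grad_sum Xxs grad_bound) => //.
        by move=> s i iln; exact: (reach [::] 0%N).
      move=> i; rewrite /eta /stepsize /= qE mulr0 addr0 /c.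
      by rewrite invfM !mulrA.
    rewrite ler_wpM2r ?invr_ge0 ?(ltW N0) //.
    by apply: le_trans (ler_norm _) _; rewrite /Q lerDr.
  - move=> k k1; rewrite mulrDr; apply: mean_sqr_dist_step => p pk.
    rewrite -mulrDr.
    apply: (crude_epoch n2 L0 lip grad_sum Xxs grad_bound _ _ _
             (fun i => etaE k i k1)).
      by rewrite divr_ge0 // ltW.
    rewrite mulrAC ler_pdivrMr // ler_wpM2l ?(ltW c0) //.
    by rewrite lerDr ltW.
  move=> k Kk; apply: mean_sqr_dist_step => p pk.
  have k1 : (1 <= k)%N by rewrite (leq_trans _ Kk) // /K0 addn_gt0.
  have e0 : 0 < c / (q + n%:R * k%:R + n%:R) by rewrite divr_gt0.
  have hs := small k Kk.
  have t4 : c / (q + n%:R * k%:R + n%:R) * L * n%:R <= 1 / 4.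
    have : c / (q + n%:R * k%:R + n%:R) * n%:R <= 1 / (4 * L).
      by apply: le_trans hs _; rewrite /small_step ge_min lexx.
    rewrite ler_pdivlMr ?mulr_gt0 //; lra.
  apply: le_trans (constant_step_epoch mono n2 L0 lip grad_sum Xxs grad_bound
    (fun i => etaE k i k1) e0 (fun s i => reach p k s i pk) t4 nu01 hrho
    (taylor _)) _.
  apply: contraction_bound => //.
  by rewrite enorm_ge0 dist.
pose phi (p : seq 'S_n) :=
  enorm (path_point (f := f) (eta := eta) (y0 := y0) p K - xs) ^+ 2.
have -> : (fun w => enorm (rr_point f (stepsize zeta L mu n) y0 (sigma ^~ w) K
      - xs) ^+ 2) = (fun w => phi [seq sigma k w | k <- iota 0 K]).
  apply/funext => w; rewrite /phi /path_point; congr (enorm (_ - _) ^+ 2).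
  apply: eq_rr_point => k kK.
  by rewrite (nth_map 0%N) ?size_iota // nth_iota.
rewrite (expectation_path unif indep) => [|p]; last exact: sqr_ge0.
rewrite lee_fin -/(a K); apply: le_trans aK _.
rewrite !qE /rate mul1r.
have h1 : 0 <= ((q + n%:R * 0%:R) / (q + n%:R * K%:R)) `^ zeta *
    enorm (y0 - xs) ^+ 2 by rewrite mulr_ge0 ?powR_ge0 ?sqr_ge0.
by move: h1; rewrite !mulrDr !mulrA; lra.
Qed.
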